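(* Let $n\in\mathbb{R}$ and $\ell=-\frac12+i\lambda$ with $\lambda\in\mathbb{R}$ be fixed, and let $\epsilon\in\mathbb{R}$ with $n\in\epsilon+\mathbb{Z}$. Then $$\frac{(2x)^{\ell+1}}{\sqrt2}\sum_{m\in\epsilon+\mathbb{Z}}e^{-i\pi m}\,\mathfrak{P}_{mn}^{\ell}(x)\;c_{[\frac mx,\frac{m+1}x[}\ \to\ \widehat{\mathbf{e}_n}\qquad\text{for } x\to\infty$$ in $L^2(\mathbb{R})$ (with respect to $\|\cdot\|_2$).
   Context: $c_M$ denotes the indicator function of a set $M$. Coefficient functions: let $\ell=-\frac12+i\lambda$, $\lambda\in\mathbb{R}$. For $m\in\mathbb{R}$ define $\mathbf{e}_m\in L^2(\mathbb{R})$ by $\mathbf{e}_m(t)=\frac{1}{\sqrt{\pi}}\,e^{-i\pi m}\,e^{2im\arctan t}\,(t^2+1)^{\ell}$ (for each $\epsilon\in\mathbb{R}$, the family $(\mathbf{e}_m)_{m\in\epsilon+\mathbb{Z}}$ is an orthonormal basis of $L^2(\mathbb{R})$; with $\chi=(\ell,\epsilon)$, $\mathbf{e}_m$ is the paper's basis vector $e^\chi_{m-\epsilon}$). For $m,n\in\mathbb{R}$ with $m-n\in\mathbb{Z}$ and $x\ge1$, write $x=\cosh 2\tau$ with the unique $\tau\ge 0$ and put $$\mathfrak{P}_{mn}^{\ell}(x)=\int_{\mathbb{R}} e^{-2\ell\tau}\,\mathbf{e}_n(e^{2\tau}t)\,\overline{\mathbf{e}_m(t)}\,dt .$$ The Fourier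 transform is $\hat f(y)=\frac1{\sqrt{2\pi}}\int_{\mathbb{R}}e^{-ity}f(t)\,dt$ for $f\in L^1(\mathbb{R})$, extended to $L^2(\mathbb{R})$ as a unitary operator (Plancherel). *)

(* Defs.v *)
From mathcomp Require Import all_boot all_order all_algebra.
From mathcomp Require Import complex.
From mathcomp Require Import all_classical all_reals all_analysis.

Set Implicit Arguments.
Unset Strict Implicit.
Unset Printing Implicit Defensive.

Import Order.TTheory GRing.Theory Num.Theory.
Import numFieldNormedType.Exports.

Local Open Scope classical_set_scope.
Local Open Scope complex_scope.
Local Open Scope ring_scope.

(* Complex exponential, and a ^ z for a real base a > 0, with the principal
   logarithm. *)
Definition cexp (R : realType) (z : R[i]) : R[i] :=
  (expR (complex.Re z))%:C * (cos (complex.Im z) +i* sin (complex.Im z)).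

Definition cpow (R : realType) (a : R) (z : R[i]) : R[i] :=
  cexp (z * (ln a)%:C).

Definition cosh (R : realType) (t : R) : R := (expR t + expR (- t)) / 2.

Definition absc (R : realType) (z : R[i]) : R := complex.Re `|z|.

(* The library integrates real-valued functions only: measurability,
   integrability and the integral of a complex-valued function are taken on
   real and imaginary parts. *)
Definition cmeasurable (R : realType) (f : R -> R[i]) : Prop :=
  measurable_fun [set: R] (fun t => complex.Re (f t)) /\
  measurable_fun [set: R] (fun t => complex.Im (f t)).

Definition cintegral (R : realType) (f : R -> R[i]) : R[i] :=
  (\int[@lebesgue_measure R]_t complex.Re (f t)) +i*
  (\int[@lebesgue_measure R]_t complex.Im (f t)).

(* Functions are not quotiented by a.e. equality: L^2 limits below are
   determined up to a.e. equality only. *)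
Definition norm2 (R : realType) (f : R -> R[i]) : \bar R :=
  'N[@lebesgue_measure R]_2%:E[(fun t => (absc (f t))%:E)]%E.

Definition inL2 (R : realType) (f : R -> R[i]) : Prop :=
  cmeasurable f /\ (norm2 f < +oo)%E.

Definition inL1 (R : realType) (f : R -> R[i]) : Prop :=
  (@lebesgue_measure R).-integrable [set: R]
    (fun t => (complex.Re (f t))%:E) /\
  (@lebesgue_measure R).-integrable [set: R]
    (fun t => (complex.Im (f t))%:E).

Definition cvgL2 (R : realType) (I : Type) (F : set_system I)
    (f : I -> R -> R[i]) (g : R -> R[i]) : Prop :=
  [/\ \forall i \near F, inL2 (f i), inL2 g &
      norm2 (fun t => f i t - g t) @[i --> F] --> 0%E].

Definition fourierL1 (R : realType) (f : R -> R[i]) (y : R) : R[i] :=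
  (Num.sqrt (2 * pi))^-1%:C *
  cintegral (fun t => cexp (- ('i%C * (t * y)%:C)) * f t).

(* g is a value at f of the continuous (by Plancherel, unitary) extension to
   L^2 of the Fourier transform, which is densely defined on the intersection
   of L^1 and L^2. *)
Definition is_fourierL2 (R : realType) (f g : R -> R[i]) : Prop :=
  exists2 u : nat -> R -> R[i],
    (forall k, inL1 (u k) /\ inL2 (u k)) &
    cvgL2 \oo u f /\ cvgL2 \oo (fun k => fourierL1 (u k)) g.

(* For f in L^2, such a g exists and is unique up to a.e. equality; the
   transform is one of these representatives.  The default 0 is only used when
   f is not in L^2. *)
Definition fourierL2 (R : realType) (f : R -> R[i]) : R -> R[i] :=
  xget (fun=> 0) [set g | is_fourierL2 f g].

Definition basis_fun (R : realType) (l : R[i]) (m t : R) : R[i] :=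
  (Num.sqrt pi)^-1%:C * cexp (- ('i%C * (pi * m)%:C)) *
  cexp ('i%C * (2 * m * atan t)%:C) * cpow (t ^+ 2 + 1) l.

(* For 1 <= x, the unique tau >= 0 with x = cosh (2 tau). *)
Definition half_arcosh (R : realType) (x : R) : R :=
  xget 0 [set tau | 0 <= tau /\ x = cosh (2 * tau)].

Definition coefP (R : realType) (l : R[i]) (m n x : R) : R[i] :=
  let tau := half_arcosh x in
  cintegral (fun t =>
    cexp (- (2 * l * tau%:C)) *
    basis_fun l n (expR (2 * tau) * t) * (basis_fun l m t)^*%C).

Definition coset_int (R : realType) (eps : R) : set R :=
  [set eps + k%:~R | k in [set: int]].

(* For x > 0 the intervals [m/x, (m+1)/x[, with m in eps + Z, partition the
   line, so that at each y the sum (over the finite support of its summand)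
   has at most one nonzero term. *)
Definition step_fun (R : realType) (l : R[i]) (eps n x y : R) : R[i] :=
  cpow (2 * x) (l + 1) / (Num.sqrt 2)%:C *
  \sum_(m \in coset_int eps)
     (cexp (- ('i%C * (pi * m)%:C)) * coefP l m n x *
      \1_(`[m / x, (m + 1) / x[%classic) y).

(* Main.v *)
(* The matrix coefficients are oscillatory integrals.  Put d = e^(-2 tau), so
   that 2 x d = 1 + d^2.  After the substitution t = d s the step function at y
   equals, for the m in eps + Z with m <= x y < m + 1,
     sqrt(1 + d^2) / (pi sqrt 2) * int amp_d(s) e^(i (al + phase_d(s) - p(s))) ds
   with amp_d(s) = (1 + s^2)^(-1/2) (1 + d^2 s^2)^(-1/2) and
   p(s) = 2 m arctan (d s), which tends to y s as x -> oo, while the Fourier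
   transform of e_n truncated to [-k, k] is the same integral over [-k, k] with
   d = 0 and p(s) = y s.  Since p' = w / (1 + d^2 s^2) with w = 2 m d in the
   first case and w = y in the second, both are handled by a single integration
   by parts.  It bounds the tails uniformly, hence gives pointwise convergence
   for y != 0, and it bounds the square of either integral by a multiple of the
   integrable function 1 / (sqrt |y| (1 + |y|)).  Dominated convergence in y
   then yields L^2 convergence to the same limit for both.

   No Plancherel theorem is needed to know that the transform of e_n is that
   limit: if u_k -> f and the transforms of u_k tend to g in L^2, then pairing
   with the indicator of [a, b] and using Fubini shows that the integral of g
   over [a, b] depends on f only, so g is determined almost everywhere. *)
Require Import Defs.
From mathcomp Require Import all_boot all_order all_algebra.
From mathcomp Require Import complex.
From mathcomp Require Import all_classical all_reals all_analysis.
From mathcomp Require Import measurable_realfun.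
From mathcomp Require Import ring lra.

Set Implicit Arguments.
Unset Strict Implicit.
Unset Printing Implicit Defensive.

Import Order.TTheory GRing.Theory Num.Theory.
Import numFieldNormedType.Exports.

Local Open Scope classical_set_scope.
Local Open Scope ring_scope.

(** * The oscillatory integrals *)

Section Oscillatory.
Context {R : realType}.
Implicit Types (a b d n la al w x y s t M N : R) (p : R -> R).
Notation mu := (@lebesgue_measure R).

(* The Japanese bracket <d s>. *)
Definition jap d s : R := Num.sqrt (1 + (d * s) ^+ 2).

Lemma one_add_sqr_gt0 x : 0 < 1 + x ^+ 2.
Proof. by rewrite ltr_pwDl// sqr_ge0. Qed.

Lemma jap_ge1 d s : 1 <= jap d s.
Proof. by rewrite -sqrtr1 ler_wsqrtr// lerDl sqr_ge0. Qed.

Lemma jap_gt0 d s : 0 < jap d s.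
Proof. exact: lt_le_trans (jap_ge1 d s). Qed.

Lemma jap_neq0 d s : jap d s != 0.
Proof. by rewrite gt_eqF// jap_gt0. Qed.

Lemma sqr_jap d s : jap d s ^+ 2 = 1 + (d * s) ^+ 2.
Proof. by rewrite sqr_sqrtr// ltW// one_add_sqr_gt0. Qed.

Lemma jap0 s : jap 0 s = 1.
Proof. by rewrite /jap mul0r expr0n addr0 sqrtr1. Qed.

Lemma japN d s : jap d (- s) = jap d s.
Proof. by rewrite /jap mulrN sqrrN. Qed.

Lemma ler_norm_jap d s : `|d * s| <= jap d s.
Proof. by rewrite -sqrtr_sqr ler_wsqrtr// lerDr. Qed.

Lemma derive_eq (f : R -> R) x (a b : R) :
  is_derive x 1 f a -> a = b -> is_derive x 1 f b.
Proof. by move=> h <-. Qed.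

Lemma is_derive_comp (f g : R -> R) x (a b : R) :
  is_derive (g x) 1 f a -> is_derive x 1 g b ->
  is_derive x 1 (fun t => f (g t)) (a * b).
Proof. exact: is_derive1_comp. Qed.

Lemma is_derive_one_add_sqr d s :
  is_derive s 1 (fun t => 1 + (d * t) ^+ 2) (2 * d ^+ 2 * s).
Proof.
have h : is_derive s 1 (fun t : R => d * t) d.
  by apply: is_derive_eq; rewrite /GRing.scale/= mulr1.
apply: is_derive_eq; rewrite /GRing.scale/=; ring.
Qed.

Lemma is_derive_jap d s : is_derive s 1 (jap d) (d ^+ 2 * s / jap d s).
Proof.
have h0 := is_derive_one_add_sqr d s.
have h1 := is_derive1_sqrt (one_add_sqr_gt0 (d * s)).
apply: (derive_eq (@is_derive_comp Num.sqrt (fun t => 1 + (d * t) ^+ 2) _ _ _ h1 h0)).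
rewrite -/(jap d s); have := jap_neq0 d s; move: (jap d s) => j j0.
by field.
Qed.

Lemma is_derive_ln_one_add_sqr d s :
  is_derive s 1 (fun t => ln (1 + (d * t) ^+ 2)) (2 * d ^+ 2 * s / jap d s ^+ 2).
Proof.
have h0 := is_derive_one_add_sqr d s.
have h1 := is_derive1_ln (one_add_sqr_gt0 (d * s)).
apply: (derive_eq (@is_derive_comp (@ln R) (fun t => 1 + (d * t) ^+ 2) _ _ _ h1 h0)).
by rewrite sqr_jap mulrC.
Qed.

Definition amp d s : R := (jap 1 s)^-1 * (jap d s)^-1.

Definition phase n la d s : R :=
  2 * n * atan s - la * (ln (1 + (d * s) ^+ 2) - ln (1 + s ^+ 2)).

Definition osc n la d al p s : R := amp d s * cos (al + phase n la d s - p s).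

(* The boundary term of the integration by parts: [quo d s / jap d s ^+ 2 = amp d s]. *)
Definition quo d s : R := jap d s / jap 1 s.

Definition dquo d s : R := s * (d ^+ 2 - 1) / (jap d s * jap 1 s ^+ 3).

Definition remd n la d al p s : R :=
  let Phi := al + phase n la d s - p s in
  dquo d s * sin Phi +
  cos Phi * (2 * n * quo d s / jap 1 s ^+ 2 - 2 * la * dquo d s).

Lemma is_derive_quo d s : is_derive s 1 (quo d) (dquo d s).
Proof.
have h1 := is_derive_jap d s.
have h2 := is_derive_jap 1 s.
have h3 := is_deriveV (jap_neq0 1 s) h2.
apply: (derive_eq (is_deriveM h1 h3)).
have e : d ^+ 2 * jap 1 s ^+ 2 - jap d s ^+ 2 = d ^+ 2 - 1.
  by rewrite !sqr_jap; ring.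
rewrite /dquo /GRing.scale/= -e.
have j1 := jap_neq0 d s; have j2 := jap_neq0 1 s.
move: (jap d s) (jap 1 s) j1 j2 => u v j1 j2.
by field; rewrite j1 j2.
Qed.

Lemma is_derive_phase n la d s : is_derive s 1 (phase n la d)
  (2 * n / jap 1 s ^+ 2 - la * (2 * d ^+ 2 * s / jap d s ^+ 2 - 2 * s / jap 1 s ^+ 2)).
Proof.
have h1 := is_derive_ln_one_add_sqr d s.
have h2 : is_derive s 1 (fun t => ln (1 + t ^+ 2)) (2 * s / jap 1 s ^+ 2).
  have := is_derive_ln_one_add_sqr 1 s.
  rewrite expr1n mulr1; congr (is_derive _ _ _ _).
  by apply/funext => t; rewrite mul1r.
have h3 := is_derive1_atan s.
apply: is_derive_eq; rewrite /GRing.scale/= !sqr_jap mul1r.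
have a0 := one_add_sqr_gt0 s; have b0 := one_add_sqr_gt0 (d * s).
by field; rewrite !gt_eqF.
Qed.

Lemma continuous_mul (f g : R -> R) : continuous f -> continuous g ->
  continuous (fun x => f x * g x).
Proof. by move=> cf cg x; apply: continuousM; [exact: cf|exact: cg]. Qed.

Lemma continuous_add (f g : R -> R) : continuous f -> continuous g ->
  continuous (fun x => f x + g x).
Proof. by move=> cf cg x; apply: continuousD; [exact: cf|exact: cg]. Qed.

Lemma continuous_sub (f g : R -> R) : continuous f -> continuous g ->
  continuous (fun x => f x - g x).
Proof. by move=> cf cg x; apply: continuousB; [exact: cf|exact: cg]. Qed.

Lemma continuous_inv (f : R -> R) : (forall x, f x != 0) -> continuous f ->
  continuous (fun x => (f x)^-1).
Proof. by move=> f0 cf x; apply: continuousV; [exact: f0|exact: cf]. Qed.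

Lemma continuous_exp (f : R -> R) k : continuous f -> continuous (fun x => f x ^+ k).
Proof.
move=> cf; elim: k => [|k IH]; first exact: cst_continuous.
have -> : (fun x => f x ^+ k.+1) = (fun x => f x * f x ^+ k).
  by apply/funext => x; rewrite exprS.
exact: continuous_mul.
Qed.

Lemma continuous_compose (f g : R -> R) : continuous f -> continuous g ->
  continuous (fun x => f (g x)).
Proof.
by move=> cf cg x; apply: (@continuous_comp _ _ _ g f); [exact: cg|exact: cf].
Qed.

Lemma continuous_const a : continuous (fun _ : R => a).
Proof. by move=> x; exact: cst_continuous. Qed.

Lemma continuous_idfun : continuous (fun x : R => x).
Proof. by move=> x; exact: cvg_id. Qed.

Lemma continuous_norm : continuous (fun x : R => `|x|).
Proof. by move=> x; exact: norm_continuous. Qed.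

Lemma is_derive_continuous (f f' : R -> R) :
  (forall s, is_derive s 1 f (f' s)) -> continuous f.
Proof.
move=> df s; apply: differentiable_continuous.
by apply/derivable1_diffP; have [] := df s.
Qed.

Lemma Rintegral_primitive (F f : R -> R) a b : a <= b ->
  (forall s, is_derive s 1 F (f s)) -> continuous f ->
  \int[mu]_(s in `[a, b]) f s = F b - F a.
Proof.
rewrite le_eqVlt => /predU1P[->|ab] dF cf.
  by rewrite set_itv1 Rintegral_set1 subrr.
have cF := is_derive_continuous dF.
rewrite /Rintegral (@continuous_FTC2 _ f F)//.
- by apply: continuous_subspaceT => x; exact: cf.
- split.
  + by move=> x _; have [] := dF x.
  + exact: cvg_at_right_filter (cF a).
  + exact: cvg_at_left_filter (cF b).
- by move=> x _; rewrite derive1E; exact: derive_val.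
Qed.

Lemma integrable_continuous_itv (f : R -> R) a b : continuous f ->
  mu.-integrable `[a, b] (EFin \o f).
Proof.
move=> cf; apply: continuous_compact_integrable; first exact: segment_compact.
by apply: continuous_subspaceT => x; exact: cf.
Qed.

Lemma continuous_jap d : continuous (jap d).
Proof. exact: is_derive_continuous (is_derive_jap d). Qed.

Lemma continuous_amp d : continuous (amp d).
Proof.
by apply: continuous_mul; apply: continuous_inv => [x|]; [exact: jap_neq0|exact: continuous_jap|
  exact: jap_neq0|exact: continuous_jap].
Qed.

Lemma continuous_phase n la d : continuous (phase n la d).
Proof. exact: is_derive_continuous (is_derive_phase n la d). Qed.

Lemma continuous_osc n la d al p : continuous p -> continuous (osc n la d al p).
Proof.
move=> cp; apply: continuous_mul; first exact: continuous_amp.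
apply: (continuous_compose (@continuous_cos R)); apply: continuous_sub => //.
by apply: continuous_add; [exact: continuous_const|exact: continuous_phase].
Qed.

Lemma is_derive_atan_jap s : is_derive s 1 atan ((jap 1 s ^+ 2)^-1).
Proof. by apply: (derive_eq (is_derive1_atan s)); rewrite sqr_jap mul1r. Qed.

Lemma continuous_invr_sqr_jap d : continuous (fun s => (jap d s ^+ 2)^-1).
Proof.
apply: continuous_inv => [x|]; first by rewrite expf_neq0// jap_neq0.
by apply: continuous_exp; exact: continuous_jap.
Qed.

Lemma Rintegral_itv_split (f : R -> R) a b c : continuous f -> a <= b -> b <= c ->
  \int[mu]_(s in `[a, c]) f s =
  \int[mu]_(s in `[a, b]) f s + \int[mu]_(s in `[b, c]) f s.
Proof.
move=> cf ab bc.
have := @Rintegral_itvB R f (BLeft a) (BRight c) b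
  (integrable_continuous_itv _ _ cf).
rewrite !bnd_simp => /(_ ab bc) /eqP; rewrite subr_eq addrC => /eqP ->.
congr (_ + _); apply: Rintegral_itv_obnd_cbnd.
apply: integrableS (integrable_continuous_itv b c cf) => //.
exact: subset_itv_oc_cc.
Qed.

Lemma jap_le d s : 0 <= d * s -> jap d s <= 1 + d * s.
Proof.
move=> ds; rewrite -(@ler_pXn2r _ 2)// ?nnegrE ?addr_ge0//; last exact: ltW (jap_gt0 _ _).
rewrite sqr_jap; nra.
Qed.

Lemma quo_le d s : 0 <= d -> 0 < s -> quo d s <= d + s^-1.
Proof.
move=> d0 s0; rewrite /quo ler_pdivrMr ?jap_gt0//.
have h1 : jap d s <= 1 + d * s by apply: jap_le; rewrite mulr_ge0// ltW.
have h2 : s <= jap 1 s by have := ler_norm_jap 1 s; rewrite mul1r gtr0_norm.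
apply: le_trans h1 _; have -> : 1 + d * s = (d + s^-1) * s.
  by field; rewrite gt_eqF.
by rewrite ler_wpM2l// addr_ge0// invr_ge0 ltW.
Qed.

Lemma quoN d s : quo d (- s) = quo d s.
Proof. by rewrite /quo !japN. Qed.

Lemma atan_sub_le M N : 0 < M -> M <= N -> atan N - atan M <= M^-1.
Proof.
rewrite le_eqVlt => M0 /predU1P[<-|MN].
  by rewrite subrr invr_ge0 ltW.
have dv (c : R) : 0 < c -> is_derive c 1 (fun t : R => t^-1) (- c ^- 2).
  move=> c0; have c1 : c != 0 by rewrite gt_eqF.
  apply: (derive_eq (is_deriveV c1 (is_derive_id c 1))).
  by rewrite /GRing.scale/= mulr1.
have da (c : R) : 0 < c -> is_derive c 1 (fun t : R => atan t + t^-1)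
    ((1 + c ^+ 2)^-1 + - c ^- 2).
  move=> c0; have h1 := dv c c0; have h2 := is_derive1_atan c.
  exact: (is_deriveD h2 h1).
have [||c] := @MVT R (fun t => atan t + t^-1)
  (fun c => (1 + c ^+ 2)^-1 + - c ^- 2) _ _ MN.
- by move=> c; rewrite in_itv/= => /andP[Mc _]; apply: da; exact: lt_trans Mc.
- apply: derivable_within_continuous => c; rewrite in_itv/= => /andP[Mc _].
  by have [] := da c (lt_le_trans M0 Mc).
rewrite in_itv/= => /andP[Mc _] e.
have c0 := lt_trans M0 Mc.
have h : (1 + c ^+ 2)^-1 + - c ^- 2 <= 0.
  by rewrite subr_le0 lef_pV2 ?posrE ?exprn_gt0 ?one_add_sqr_gt0// lerDr.
have : atan N + N^-1 - (atan M + M^-1) <= 0 by rewrite e; apply: mulr_le0_ge0 => //; rewrite subr_ge0 ltW.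
have : 0 < N^-1 by rewrite invr_gt0 (lt_trans M0).
lra.
Qed.

(* The inverse hyperbolic sine, a primitive of [1 / jap 1]. *)
Definition ash s : R := ln (s + jap 1 s).

Lemma add_jap_gt0 s : 0 < s + jap 1 s.
Proof.
have : `|s| < jap 1 s.
  rewrite -sqrtr_sqr ltr_sqrt ?mul1r ?ltrDr//; exact: one_add_sqr_gt0.
by rewrite ltr_norml => /andP[h _]; lra.
Qed.

Lemma is_derive_ash s : is_derive s 1 ash ((jap 1 s)^-1).
Proof.
have h1 := is_derive_jap 1 s.
have h2 : is_derive s 1 (fun t : R => t + jap 1 t) (1 + 1 ^+ 2 * s / jap 1 s).
  exact: is_deriveD.
have h3 := is_derive1_ln (add_jap_gt0 s).
apply: (derive_eq (@is_derive_comp (@ln R) (fun t => t + jap 1 t) _ _ _ h3 h2)).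
have := jap_neq0 1 s; have := lt0r_neq0 (add_jap_gt0 s).
by move=> a0 b0; field; rewrite a0 b0.
Qed.

Lemma ashN s : ash (- s) = - ash s.
Proof.
rewrite /ash japN -lnV ?posrE ?add_jap_gt0//; congr ln.
apply: (mulIf (lt0r_neq0 (add_jap_gt0 s))); rewrite mulVf ?(lt0r_neq0 (add_jap_gt0 s))//.
have := sqr_jap 1 s; move: (jap 1 s) => j; rewrite mul1r => e.
by have -> : (- s + j) * (s + j) = j ^+ 2 - s ^+ 2; [ring|rewrite e; ring].
Qed.

Lemma ash_le M : 0 <= M -> ash M <= 4 * Num.sqrt (Num.sqrt (2 * M)).
Proof.
move=> M0; set z := Num.sqrt (Num.sqrt _).
have z0 : 0 <= z by exact: sqrtr_ge0.
have z4 : z ^+ 4 = 2 * M.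
  by rewrite (exprM _ 2 2) !sqr_sqrtr ?sqrtr_ge0// mulr_ge0.
have h : M + jap 1 M <= (1 + z) ^+ 4.
  apply: (@le_trans _ _ (1 + z ^+ 4)).
    have := @jap_le 1 M; rewrite !mul1r => /(_ M0); rewrite z4; lra.
  rewrite -subr_ge0 (_ : _ - _ = 4 * z + 6 * z ^+ 2 + 4 * z ^+ 3); last by ring.
  by rewrite !addr_ge0// mulr_ge0// exprn_ge0.
apply: (@le_trans _ _ (ln ((1 + z) ^+ 4))).
  by rewrite ler_ln ?posrE ?add_jap_gt0// exprn_gt0// ltr_wpDr.
have -> : ln ((1 + z) ^+ 4) = 4 * ln (1 + z) by rewrite lnXn ?ltr_wpDr// mulr_natl.
rewrite ler_wpM2l//.
apply: le_ln1Dx; lra.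
Qed.

Lemma amp_gt0 d s : 0 < amp d s.
Proof. by rewrite mulr_gt0// invr_gt0 jap_gt0. Qed.

Lemma amp_le d s : amp d s <= (jap 1 s)^-1.
Proof. by rewrite /amp ler_piMr ?invr_ge0 ?invf_le1 ?jap_gt0 ?jap_ge1 ?ltW ?jap_gt0. Qed.

Lemma norm_osc_le n la d al p s : `|osc n la d al p s| <= amp d s.
Proof.
rewrite /osc; move: (amp d s) (amp_gt0 d s) => A A0.
by rewrite normrM gtr0_norm// ler_piMr ?(ltW A0)// ler_norml cos_geN1 cos_le1.
Qed.

Lemma osc_itv_le_primitive n la d al p (F f : R -> R) a b : continuous p -> a <= b ->
  (forall s, is_derive s 1 F (f s)) -> continuous f ->
  (forall s, a <= s <= b -> amp d s <= f s) ->
  `|\int[mu]_(s in `[a, b]) osc n la d al p s| <= F b - F a.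
Proof.
move=> cp ab dF cf le.
have co := @continuous_osc n la d al p cp.
apply: le_trans (le_normr_Rintegral _ (integrable_continuous_itv _ _ co)) _ => //.
rewrite -(Rintegral_primitive ab dF cf); apply: le_Rintegral => //.
- apply: (@integrable_continuous_itv (fun x => `|osc n la d al p x|)).
  exact: (continuous_compose continuous_norm co).
- exact: integrable_continuous_itv.
- move=> s /=; rewrite in_itv/= => sab; apply: le_trans (norm_osc_le _ _ _ _ _ _) _.
  exact: le.
Qed.

Lemma osc_centre_le n la d al p M : continuous p -> 0 <= M ->
  `|\int[mu]_(s in `[- M, M]) osc n la d al p s| <= 8 * Num.sqrt (Num.sqrt (2 * M)).
Proof.
move=> cp M0; apply: (@le_trans _ _ (ash M - ash (- M))).
  apply: (osc_itv_le_primitive n la al cp _ is_derive_ash); first lra.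
    by apply: continuous_inv => [x|]; [exact: jap_neq0|exact: continuous_jap].
  by move=> s _; exact: amp_le.
rewrite ashN opprK; have := ash_le M0; lra.
Qed.

Section OneIntegral.
Variables (n la d al w : R) (p : R -> R).
Hypothesis dp : forall s, is_derive s 1 p (w / jap d s ^+ 2).
Let Phi s := al + phase n la d s - p s.

Lemma is_derive_osc_primitive s :
  is_derive s 1 (fun t => quo d t * sin (Phi t))
    (remd n la d al p s - w * osc n la d al p s).
Proof.
have hq := is_derive_quo d s; have hph := is_derive_phase n la d s.
have hp := dp s.
have hPhi : is_derive s 1 Phi (2 * n / jap 1 s ^+ 2 -
    la * (2 * d ^+ 2 * s / jap d s ^+ 2 - 2 * s / jap 1 s ^+ 2) - w / jap d s ^+ 2).
  by apply: is_derive_eq; ring.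
have hs := is_derive_comp (is_derive_sin (Phi s)) hPhi.
apply: (derive_eq (is_deriveM hq hs)).
rewrite /remd /osc /GRing.scale/= -/(Phi s).
have e : d ^+ 2 * jap 1 s ^+ 2 - jap d s ^+ 2 = d ^+ 2 - 1.
  by rewrite !sqr_jap; ring.
rewrite /dquo /quo /amp -e.
have j1 := jap_neq0 d s; have j2 := jap_neq0 1 s.
move: (jap d s) (jap 1 s) (sin _) (cos _) j1 j2 => u v S C j1 j2.
by field; rewrite j1 j2.
Qed.

Hypothesis d01 : 0 <= d <= 1.

Lemma quo_ge0 s : 0 <= quo d s.
Proof. by rewrite /quo divr_ge0// ltW// jap_gt0. Qed.

Lemma quo_le1 s : quo d s <= 1.
Proof.
rewrite /quo ler_pdivrMr ?jap_gt0// mul1r ler_wsqrtr// lerD2l mul1r exprMn.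
by rewrite ler_piMl ?sqr_ge0// expr_le1//; case/andP: d01.
Qed.

Lemma norm_dquo_le s : `|dquo d s| <= (jap 1 s ^+ 2)^-1.
Proof.
rewrite /dquo.
have j1 := jap_gt0 d s; have j2 := jap_gt0 1 s.
rewrite normrM normfV (ger0_norm (ltW (mulr_gt0 j1 (exprn_gt0 3 j2)))).
rewrite ler_pdivrMr ?mulr_gt0 ?exprn_gt0//.
have -> : (jap 1 s ^+ 2)^-1 * (jap d s * jap 1 s ^+ 3) = jap 1 s * jap d s.
  by field; rewrite gt_eqF.
rewrite normrM; apply: ler_pM => //.
  by have := ler_norm_jap 1 s; rewrite mul1r.
apply: le_trans (jap_ge1 d s).
case/andP: d01 => d0 d1; have d21 : d ^+ 2 <= 1 by rewrite expr_le1.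
by rewrite ler0_norm ?subr_le0// opprB lerBlDr lerDl sqr_ge0.
Qed.

Lemma norm_remd_le s :
  `|remd n la d al p s| <= (1 + 2 * `|la| + 2 * `|n|) / jap 1 s ^+ 2.
Proof.
have j2 := jap_gt0 1 s.
have i0 : 0 <= (jap 1 s ^+ 2)^-1 by rewrite invr_ge0 sqr_ge0.
have h1 := norm_dquo_le s.
have q0 := quo_ge0 s; have q1 := quo_le1 s.
rewrite /remd; move: (al + _ - _) (quo d s) (dquo d s) h1 q0 q1 => x Q D h1 q0 q1.
apply: le_trans (ler_normD _ _) _; rewrite !normrM.
have a1 : `|D| * `|sin x| <= (jap 1 s ^+ 2)^-1.
  by rewrite -[leRHS]mulr1; apply: ler_pM => //; rewrite ler_norml sin_geN1 sin_le1.
have a2 : `|2 * n * Q / jap 1 s ^+ 2 - 2 * la * D| <=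
    2 * `|n| / jap 1 s ^+ 2 + 2 * `|la| / jap 1 s ^+ 2.
  apply: le_trans (ler_normB _ _) _; rewrite !normrM (ger0_norm i0) !normr_nat.
  rewrite (ger0_norm q0); apply: lerD.
    by rewrite ler_wpM2r// ler_piMr// mulr_ge0.
  by rewrite ler_wpM2l// mulr_ge0.
have a3 : `|cos x| <= 1 by rewrite ler_norml cos_geN1 cos_le1.
apply: le_trans (lerD a1 (ler_pM (normr_ge0 _) (normr_ge0 _) a3 a2)) _.
by rewrite [leLHS](_ : _ = (1 + 2 * `|la| + 2 * `|n|) / jap 1 s ^+ 2)//; ring.
Qed.

Definition osc_cst : R := 1 + 2 * `|la| + 2 * `|n|.

Lemma osc_itv_le a b : a <= b ->
  `|w| * `|\int[mu]_(s in `[a, b]) osc n la d al p s| <=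
  quo d a + quo d b + osc_cst * (atan b - atan a).
Proof.
move=> ab.
have cp := is_derive_continuous dp.
have co := @continuous_osc n la d al p cp.
have cq := is_derive_continuous (is_derive_quo d).
have cPhi : continuous Phi.
  by apply: continuous_sub => //; apply: continuous_add; [exact: continuous_const|exact: continuous_phase].
have cdq : continuous (dquo d).
  apply: continuous_mul; first by apply: continuous_mul; [exact: continuous_idfun|exact: continuous_const].
  apply: continuous_inv => [x|]; first by rewrite mulf_neq0// ?expf_neq0// jap_neq0.
  by apply: continuous_mul; [|apply: continuous_exp]; exact: continuous_jap.
have cr : continuous (remd n la d al p).
  apply: continuous_add; first by apply: continuous_mul => //; apply: (continuous_compose (@continuous_sin R)).
  apply: continuous_mul; first exact: (continuous_compose (@continuous_cos R)).
  apply: continuous_sub; last by apply: continuous_mul => //; exact: continuous_const.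
  apply: continuous_mul; last exact: continuous_invr_sqr_jap.
  by apply: continuous_mul => //; exact: continuous_const.
have io := @integrable_continuous_itv _ a b co.
have ir := @integrable_continuous_itv _ a b cr.
have := @Rintegral_primitive _ _ a b ab is_derive_osc_primitive.
have cwo : continuous (fun s => w * osc n la d al p s).
  by apply: continuous_mul => //; exact: continuous_const.
move=> /(_ (continuous_sub cr cwo)).
rewrite RintegralB//; last exact: integrable_continuous_itv.
rewrite RintegralZl// => h.
rewrite -normrM.
have -> : w * \int[mu]_(s in `[a, b]) osc n la d al p s =
  quo d a * sin (Phi a) - quo d b * sin (Phi b) +
   \int[mu]_(s in `[a, b]) remd n la d al p s.
  by move: h => /eqP; rewrite subr_eq => /eqP ->; ring.
apply: le_trans (ler_normD _ _) _; apply: lerD.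
  have h0 u : `|quo d u * sin (Phi u)| <= quo d u.
    move: (quo d u) (quo_ge0 u) => Q Q0; rewrite normrM ger0_norm// ler_piMr//.
    by rewrite ler_norml sin_geN1 sin_le1.
  by apply: le_trans (ler_normB _ _) _; apply: lerD; exact: h0.
apply: le_trans (le_normr_Rintegral _ ir) _ => //.
have cA : continuous (fun s => osc_cst * (jap 1 s ^+ 2)^-1).
  by apply: continuous_mul; [exact: continuous_const|exact: continuous_invr_sqr_jap].
have cB : continuous (fun s => (jap 1 s ^+ 2)^-1) := @continuous_invr_sqr_jap 1.
apply: (@le_trans _ _ (\int[mu]_(s in `[a, b]) (osc_cst * (jap 1 s ^+ 2)^-1))).
  apply: le_Rintegral => //.
  - apply: (@integrable_continuous_itv (fun x => `|remd n la d al p x|)).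
    exact: (continuous_compose continuous_norm cr).
  - exact: integrable_continuous_itv.
  - by move=> x _; exact: norm_remd_le.
rewrite RintegralZl//; last exact: integrable_continuous_itv.
by rewrite (Rintegral_primitive ab is_derive_atan_jap).
Qed.

Lemma osc_tails_le M N : 0 < M -> M <= N ->
  `|w| * `|\int[mu]_(s in `[M, N]) osc n la d al p s| <= (2 + osc_cst) * (M^-1 + d) /\
  `|w| * `|\int[mu]_(s in `[- N, - M]) osc n la d al p s| <= (2 + osc_cst) * (M^-1 + d).
Proof.
move=> M0 MN; have N0 := lt_le_trans M0 MN.
have d0 : 0 <= d by case/andP: d01.
have q1 := quo_le d0 M0; have q2 := quo_le d0 N0.
have VN : N^-1 <= M^-1 by rewrite lef_pV2.
have hA := atan_sub_le M0 MN.
have C0 : 0 <= osc_cst by rewrite !addr_ge0// mulr_ge0.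
have h : quo d M + quo d N + osc_cst * (atan N - atan M) <= (2 + osc_cst) * (M^-1 + d).
  have : osc_cst * (atan N - atan M) <= osc_cst * (M^-1 + d).
    by rewrite ler_wpM2l// (le_trans hA)// lerDl.
  lra.
split; first exact: le_trans (osc_itv_le MN) h.
have MN' : - N <= - M by rewrite lerN2.
by apply: le_trans (osc_itv_le MN') _; rewrite !quoN !atanN; lra.
Qed.

End OneIntegral.

End Oscillatory.

Section Bound.
Context {R : realType}.
Implicit Types (a b d n la al w x y s t M N T : R) (p : R -> R).
Notation mu := (@lebesgue_measure R).

Lemma osc_split n la d al p M N T : continuous p -> 0 < M -> 0 < N -> 0 <= T ->
  (M <= N -> `|\int[mu]_(s in `[M, N]) osc n la d al p s| <= T /\
    `|\int[mu]_(s in `[- N, - M]) osc n la d al p s| <= T) ->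
  `|\int[mu]_(s in `[- N, N]) osc n la d al p s| <=
    8 * Num.sqrt (Num.sqrt (2 * M)) + 2 * T.
Proof.
move=> cp M0 N0 T0 h; have [NM|/ltW MN] := leP N M.
  apply: le_trans (osc_centre_le n la d al cp (ltW N0)) _.
  rewrite -[leLHS]addr0 lerD ?mulr_ge0// ler_wpM2l// !ler_wsqrtr// ler_wpM2l//.
have [h1 h2] := h MN.
have co := @continuous_osc R n la d al p cp.
rewrite (@Rintegral_itv_split _ _ _ (- M)) ?lerN2//; last lra.
rewrite (@Rintegral_itv_split _ _ (- M) M)//; last lra.
have hc := osc_centre_le n la d al cp (ltW M0).
apply: le_trans (ler_normD _ _) _.
have := ler_normD (\int[mu]_(s in `[- M, M]) osc n la d al p s)
  (\int[mu]_(s in `[M, N]) osc n la d al p s).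
lra.
Qed.

Lemma osc_tail_abs_le n la d al p N : continuous p -> 0 < d -> d^-1 <= N ->
  `|\int[mu]_(s in `[d^-1, N]) osc n la d al p s| <= pi /\
  `|\int[mu]_(s in `[- N, - d^-1]) osc n la d al p s| <= pi.
Proof.
move=> cp d0 dN.
have i0 : 0 < d^-1 by rewrite invr_gt0.
have dF s : is_derive s 1 (fun t => 2 * atan (d * t)) (2 * d / jap d s ^+ 2).
  have h : is_derive s 1 (fun t : R => d * t) d.
    by apply: is_derive_eq; rewrite /GRing.scale/= mulr1.
  have h2 := is_derive_comp (is_derive1_atan (d * s)) h.
  apply: is_derive_eq; rewrite /GRing.scale/= sqr_jap; ring.
have cf : continuous (fun s => 2 * d / jap d s ^+ 2).
  by apply: continuous_mul; [exact: continuous_const|exact: continuous_invr_sqr_jap].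
have le s : d^-1 <= `|s| -> amp d s <= 2 * d / jap d s ^+ 2.
  move=> ds; have s0 : 0 < `|s| by exact: lt_le_trans ds.
  have j1 : `|s| <= jap 1 s by have := ler_norm_jap 1 s; rewrite mul1r.
  have jE : jap d s = jap d `|s|.
    by case: (ger0P s) => // _; rewrite japN.
  have ds1 : 1 <= d * `|s| by rewrite -ler_pdivrMl ?mulr1.
  have j2 : jap d s <= 2 * d * `|s|.
    have := @jap_le R d `|s|; rewrite -jE => /(_ (ltW _)) h.
    by have {}h := h (lt_le_trans ltr01 ds1); lra.
  have jd := jap_gt0 d s; have j10 := jap_gt0 1 s.
  rewrite /amp -[leRHS](_ : (2 * d / jap d s) * (jap d s)^-1 = _); last first.
    by field; rewrite gt_eqF.
  rewrite ler_wpM2r ?invr_ge0 ?(ltW jd)// ler_pdivlMr// ler_pdivrMl//.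
  by apply: le_trans j2 _; rewrite mulrC ler_wpM2r// mulr_ge0// ltW.
have pos x y : 0 < x -> x <= y -> `|y| = y.
  by move=> x0 xy; rewrite ger0_norm// (le_trans (ltW x0)).
have b u := atan_ltpi2 (R:=R) u; have c u := atan_gtNpi2 (R:=R) u.
have ra0 : 0 <= atan (d * d^-1).
  by rewrite mulfV ?gt_eqF// atan1 divr_ge0// ltW// pi_gt0.
split.
  have h : `|\int[mu]_(s in `[d^-1, N]) osc n la d al p s| <=
      2 * atan (d * N) - 2 * atan (d * d^-1).
    apply: (osc_itv_le_primitive n la al cp dN dF cf).
    by move=> s /andP[s1 _]; apply: le; rewrite (pos _ _ i0 s1).
  have := b (d * N); lra.
have dN' : - N <= - d^-1 by rewrite lerN2.
have h : `|\int[mu]_(s in `[- N, - d^-1]) osc n la d al p s| <=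
      2 * atan (d * - d^-1) - 2 * atan (d * - N).
  apply: (osc_itv_le_primitive n la al cp dN' dF cf).
  move=> s /andP[_ s1]; apply: le; rewrite -normrN (pos d^-1)//; lra.
have := c (d * - N); move: h; rewrite !mulrN !atanN; lra.
Qed.

Lemma sqr_le_bound (I X T : R) : 0 <= I -> 0 <= X -> 0 <= T ->
  I <= 8 * Num.sqrt (Num.sqrt X) + 2 * T ->
  I ^+ 2 <= 128 * Num.sqrt X + 8 * T ^+ 2.
Proof.
move=> I0 X0 T0 h.
have : Num.sqrt (Num.sqrt X) ^+ 2 = Num.sqrt X by rewrite sqr_sqrtr ?sqrtr_ge0.
have : 0 <= Num.sqrt (Num.sqrt X) by rewrite sqrtr_ge0.
move: (Num.sqrt X) (Num.sqrt (Num.sqrt X)) h => Y Z h Z0 <-.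
apply: (@le_trans _ _ ((8 * Z + 2 * T) ^+ 2)).
  by rewrite ler_pXn2r ?nnegrE// addr_ge0// mulr_ge0.
rewrite -subr_ge0 (_ : _ - _ = (8 * Z - 2 * T) ^+ 2); first exact: sqr_ge0.
ring.
Qed.

(* The square of a majorant of all the integrals: it leaves room for the
   logarithmic growth at [y = 0], weakened to [|y|^(-1/4)] by [ash_le], and for
   the decay in [1/|y|].  Its value at 0 is the junk value 0. *)
Definition rho y : R := (Num.sqrt `|y| * (1 + `|y|))^-1.

Lemma rho_ge0 y : 0 <= rho y.
Proof. by rewrite invr_ge0 mulr_ge0// addr_ge0. Qed.

Lemma le_rho_small (X B y : R) : y != 0 -> `|y| <= 4 -> 0 <= X ->
  X * `|y| <= 9 -> 0 <= B -> 128 * Num.sqrt X + B <= 10 * (192 + B) * rho y.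
Proof.
move=> y0; have : 0 < `|y| by rewrite normr_gt0.
rewrite /rho; move: (`|y|) => v v0 v4 X0 Xv B0.
have s0 : 0 < Num.sqrt v by rewrite sqrtr_gt0.
have sv : Num.sqrt v ^+ 2 = v by rewrite sqr_sqrtr// ltW.
have h1 : Num.sqrt X * Num.sqrt v <= 3.
  rewrite -(@ler_pXn2r _ 2) ?nnegrE ?mulr_ge0 ?sqrtr_ge0//.
  by rewrite exprMn sv sqr_sqrtr//; lra.
have h2 : Num.sqrt v <= 2 by rewrite -(@ler_pXn2r _ 2) ?nnegrE ?sqrtr_ge0// sv; lra.
rewrite ler_pdivlMr ?mulr_gt0//; last lra.
apply: (@le_trans _ _ ((128 * Num.sqrt X + B) * Num.sqrt v * 5)).
  have v5 : 1 + v <= 5 by lra.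
  rewrite mulrA; apply: ler_wpM2l => //.
  by apply: mulr_ge0; [rewrite addr_ge0// mulr_ge0// sqrtr_ge0|exact: ltW].
have h3 : B * Num.sqrt v <= B * 2 by rewrite ler_wpM2l.
lra.
Qed.

Lemma le_rho_large y : 1 <= `|y| -> (y ^+ 2)^-1 <= 2 * rho y.
Proof.
rewrite /rho -[y ^+ 2]real_normK ?num_real//; move: `|y| => v v1.
have v0 : 0 < v by lra.
have s0 : 0 < Num.sqrt v by rewrite sqrtr_gt0.
have sv : Num.sqrt v <= v.
  by rewrite -(@ler_pXn2r _ 2) ?nnegrE ?(ltW s0) ?(ltW v0)// sqr_sqrtr ?(ltW v0)//; nra.
rewrite ler_pdivlMr ?mulr_gt0//; last lra.
rewrite mulrC ler_pdivrMr ?exprn_gt0//.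
nra.
Qed.

Section Uniform.
Variables (n la d al w y : R) (p : R -> R).
Hypothesis dp : forall s, is_derive s 1 p (w / jap d s ^+ 2).
Hypothesis d01 : 0 <= d <= 1.
Hypothesis y0 : y != 0.
Hypothesis wy : `|w - (1 + d ^+ 2) * y| <= 2 * d.
Let C := osc_cst n la.
Let cp : continuous p := is_derive_continuous dp.

Lemma osc_cst_ge0 : 0 <= C.
Proof. by rewrite !addr_ge0// mulr_ge0. Qed.

Lemma freq_ge : 4 * d <= `|y| -> `|y| / 2 <= `|w|.
Proof.
move=> dy; have [d0 d1] := andP d01.
have : `|(1 + d ^+ 2) * y| <= `|w| + `|w - (1 + d ^+ 2) * y|.
  by rewrite -[X in `|X| <= _](subKr w) ler_normB.
rewrite normrM ger0_norm ?addr_ge0 ?sqr_ge0// => h.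
have {}h := le_trans h (lerD (lexx _) wy).
have : `|y| <= (1 + d ^+ 2) * `|y| by rewrite ler_peMl// lerDl sqr_ge0.
lra.
Qed.

(* One summand for each of the cases 1 <= |y|, |y| < 1 and |y| < 4 d below. *)
Definition osc_bound : R := 8 * (2 + C * pi) ^+ 2 +
  10 * (192 + 200 * (2 + C) ^+ 2) + 10 * (192 + 8 * pi ^+ 2).

Lemma osc_bound_terms : [/\ 0 <= 8 * (2 + C * pi) ^+ 2,
  0 <= 10 * (192 + 200 * (2 + C) ^+ 2) & 0 <= 10 * (192 + 8 * (pi : R) ^+ 2)].
Proof.
have s1 := sqr_ge0 (2 + C * pi); have s2 := sqr_ge0 (2 + C).
have s3 := sqr_ge0 (pi : R); split; lra.
Qed.

Lemma sqr_osc_le N : 0 < N ->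
  (\int[mu]_(s in `[- N, N]) osc n la d al p s) ^+ 2 <= osc_bound * rho y.
Proof.
move=> N0; have [d0 d1] := andP d01.
have C0 := osc_cst_ge0.
have ay : 0 < `|y| by rewrite normr_gt0.
have pi0 := pi_gt0 R.
rewrite -real_normK ?num_real//.
have hI : 0 <= `|\int[mu]_(s in `[- N, N]) osc n la d al p s| by [].
have [t1 t2 t3] := osc_bound_terms.
suff : exists2 k, k <= osc_bound &
    `|\int[mu]_(s in `[- N, N]) osc n la d al p s| ^+ 2 <= k * rho y.
  by move=> [k kK]; move/le_trans; apply; rewrite ler_wpM2r// rho_ge0.
have [dy|dy] := leP (4 * d) `|y|; last first.
  exists (10 * (192 + 8 * pi ^+ 2)); first by rewrite /osc_bound; lra.
  have d00 : 0 < d by lra.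
  have i0 : 0 < d^-1 by rewrite invr_gt0.
  have h := @osc_split n la d al p d^-1 N pi cp i0 N0 (ltW pi0)
    (osc_tail_abs_le n la al cp d00).
  have X0 : 0 <= 2 * d^-1 by rewrite mulr_ge0// ltW.
  apply: le_trans (sqr_le_bound hI X0 (ltW pi0) h) _.
  apply: le_rho_small => //; [lra| |by rewrite mulr_ge0// sqr_ge0].
  by rewrite mulrAC ler_pdivrMr//; lra.
have w0 := freq_ge dy; have w1 : 0 < `|w| by lra.
have [y1|y1] := leP 1 `|y|.
  exists (8 * (2 + C * pi) ^+ 2); first by rewrite /osc_bound; lra.
  have NN : - N <= N by lra.
  have h := @osc_itv_le R n la d al w p dp d01 _ _ NN.
  have h1 : `|\int[mu]_(s in `[- N, N]) osc n la d al p s| <= 2 * (2 + C * pi) / `|y|.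
    rewrite ler_pdivlMr//.
    have q1 := quo_le1 d01 N.
    have : C * (atan N - atan (- N)) <= C * pi.
      by rewrite ler_wpM2l//; have := atan_ltpi2 N; rewrite atanN; lra.
    have : `|y| / 2 * `|\int[mu]_(s in `[- N, N]) osc n la d al p s| <=
       `|w| * `|\int[mu]_(s in `[- N, N]) osc n la d al p s| by rewrite ler_wpM2r.
    move: h; rewrite quoN -/C; lra.
  have C1 : 0 <= 2 * (2 + C * pi) / `|y|.
    by rewrite divr_ge0// mulr_ge0// addr_ge0// mulr_ge0// ltW.
  apply: (@le_trans _ _ ((2 * (2 + C * pi) / `|y|) ^+ 2)).
    by rewrite ler_pXn2r ?nnegrE.
  rewrite exprMn exprVn real_normK ?num_real//.
  have := le_rho_large y1; set P := (2 * (2 + C * pi)) ^+ 2 => h2.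
  have -> : 8 * (2 + C * pi) ^+ 2 * rho y = P * (2 * rho y) by rewrite /P; ring.
  by rewrite ler_wpM2l// sqr_ge0.
exists (10 * (192 + 8 * (5 * (2 + C)) ^+ 2)); first by rewrite /osc_bound; lra.
have i0 : 0 < `|y|^-1 by rewrite invr_gt0.
have T0 : 0 <= 5 * (2 + C) by lra.
have h0 (I : R) : `|w| * I <= (2 + C) * (`|y|^-1^-1 + d) -> 0 <= I -> I <= 5 * (2 + C).
  rewrite invrK => h I0; rewrite -(@ler_pM2l _ (`|y| / 2)) ?divr_gt0//.
  have h1 : `|y| / 2 * I <= `|w| * I by rewrite ler_wpM2r.
  have h2 : (2 + C) * (`|y| + d) <= (2 + C) * (`|y| * (5 / 4)) by rewrite ler_wpM2l; lra.
  have h3 : 0 <= C * `|y| by rewrite mulr_ge0// ltW.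
  lra.
have h := @osc_split n la d al p `|y|^-1 N (5 * (2 + C)) cp i0 N0 T0.
have {}h : `|\int[mu]_(s in `[- N, N]) osc n la d al p s| <=
    8 * Num.sqrt (Num.sqrt (2 * `|y|^-1)) + 2 * (5 * (2 + C)).
  apply: h => yN; have [h1 h2] := osc_tails_le n la al dp d01 i0 yN.
  by split; apply: h0.
have X0 : 0 <= 2 * `|y|^-1 by rewrite mulr_ge0// ltW.
apply: le_trans (sqr_le_bound hI X0 T0 h) _.
apply: le_rho_small => //; [lra| |by rewrite mulr_ge0// sqr_ge0].
by rewrite mulrAC ler_pdivrMr//; lra.
Qed.

End Uniform.
End Bound.

(** * Integrability and dominated convergence *)

Section GenericIntegrability.
Context {R : realType}.
Notation mu := (@lebesgue_measure R).
Notation T := (measurableTypeR R).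

Lemma le_integrable_real (D : set T) (f g : T -> R) : measurable D ->
  measurable_fun D f -> (forall x, D x -> `|f x| <= g x) ->
  mu.-integrable D (EFin \o g) -> mu.-integrable D (EFin \o f).
Proof.
move=> mD mf fg; apply: le_integrable => //; first exact/measurable_EFinP.
move=> x Dx; rewrite /= lee_fin; apply: le_trans (fg x Dx) _.
exact: ler_norm.
Qed.

Lemma integrable_bigcup_le (E : (set T)^nat) (f : T -> R) (B : R) :
  nondecreasing_seq E -> (forall i, measurable (E i)) ->
  measurable_fun (\bigcup_i E i) f -> (forall x, 0 <= f x) ->
  (forall i, (\int[mu]_(x in E i) (f x)%:E <= B%:E)%E) ->
  mu.-integrable (\bigcup_i E i) (EFin \o f).
Proof.
move=> ndE mE mf f0 le.
have mU : measurable (\bigcup_i E i) by exact: bigcup_measurable.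
apply/integrableP; split; first exact/measurable_EFinP.
apply: (@le_lt_trans _ _ B%:E); last exact: ltry.
under eq_integral do rewrite /= ger0_norm//.
have mfi i : measurable_fun (E i) (EFin \o f).
  apply/measurable_EFinP; apply: measurable_funS mf => //.
  exact: bigcup_sup.
have fi0 i x : E i x -> (0 <= (EFin \o f) x)%E by rewrite /= lee_fin.
apply: (cvge_to_le (ge0_nondecreasing_set_cvg_integral ndE mE mfi fi0)).
by apply: nearW => i; exact: le.
Qed.

Lemma dominated_cvg_real (D : set T) (f_ : nat -> T -> R) (f g : T -> R) :
  measurable D -> (forall k, measurable_fun D (f_ k)) ->
  (forall x, D x -> f_ k x @[k --> \oo] --> f x) ->
  mu.-integrable D (EFin \o g) -> (forall k x, D x -> `|f_ k x| <= g x) ->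
  mu.-integrable D (EFin \o f) /\
  \int[mu]_(x in D) f_ k x @[k --> \oo] --> \int[mu]_(x in D) f x.
Proof.
move=> mD mf_ cvf ig le.
have mf : measurable_fun D f.
  exact: (@measurable_fun_cvg _ T R D f_ f mf_ cvf).
have emf_ k : measurable_fun D (EFin \o f_ k) by exact/measurable_EFinP.
have emf : measurable_fun D (EFin \o f) by exact/measurable_EFinP.
have ecv : {ae mu, forall x, D x -> (EFin \o f_ k) x @[k --> \oo] --> (EFin \o f) x}.
  apply: aeW => x Dx; apply: cvg_EFin; last exact: cvf.
  exact: nearW.
have ele : {ae mu, forall x k, D x -> (`|(EFin \o f_ k) x| <= (EFin \o g) x)%E}.
  by apply: aeW => x k Dx; rewrite /= lee_fin; exact: le.
have [i1 _ i3] := dominated_convergence mD emf_ emf ecv ig ele.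
split=> //; apply: fine_cvg; rewrite fineK//.
exact: integrable_fin_num.
Qed.

End GenericIntegrability.

Section Integrability.
Context {R : realType}.
Implicit Types (a b d n la al w x y s t M N T : R) (p : R -> R).
Notation mu := (@lebesgue_measure R).

Lemma cvg_Rintegral_symm_itv (f : R -> R) : mu.-integrable setT (EFin \o f) ->
  \int[mu]_(x in `[- k%:R, k%:R]) f x @[k --> \oo] --> \int[mu]_x f x.
Proof.
move=> fi.
have mf : measurable_fun setT f by apply/measurable_EFinP; exact: measurable_int fi.
have mf_ (k : nat) : measurable_fun setT (f \_ `[- k%:R, k%:R]).
  by apply/(measurable_restrictT f) => //; exact: measurable_funTS.
have cvf x : setT x -> (f \_ `[- k%:R, k%:R]) x @[k --> \oo] --> f x.
  move=> _; apply: cvg_near_cst; near=> k.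
  rewrite patchE mem_set//= in_itv/= -ler_norml.
  by near: k; exact: nbhs_infty_ger.
have le (k : nat) x : setT x -> `|(f \_ `[- k%:R, k%:R]) x| <= `|f x|.
  by move=> _; rewrite patchE; case: ifP => // _; rewrite normr0.
have [_] := @dominated_cvg_real R setT _ f (fun x => `|f x|) measurableT mf_ cvf (integrable_norm fi) le.
under eq_fun do rewrite -Rintegral_mkcond.
by [].
Unshelve. all: by end_near. Qed.

Lemma EFin_Rintegral_itv (f : R -> R) a b : {within `[a, b], continuous f} ->
  (\int[mu]_(x in `[a, b]) (f x)%:E = (\int[mu]_(x in `[a, b]) f x)%:E)%E.
Proof.
move=> cf; rewrite /Rintegral fineK//.
apply: integrable_fin_num => //.
by apply: continuous_compact_integrable => //; exact: segment_compact.
Qed.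

Lemma bigcup_symm_itv : \bigcup_i `[- i%:R, i%:R]%classic = [set: R].
Proof.
rewrite -subTset => x _; exists (Num.truncn `|x|).+1 => //=.
by rewrite in_itv/= -ler_norml ltW// truncnS_gt.
Qed.

Lemma integrable_invr_sqr_jap : mu.-integrable setT (EFin \o (fun s => (jap 1 s ^+ 2)^-1)).
Proof.
have cf := @continuous_invr_sqr_jap R 1.
rewrite -bigcup_symm_itv; apply: (@integrable_bigcup_le R _ _ pi).
- move=> i j ij; apply/subsetPset => x /=; rewrite !in_itv/= -!ler_norml.
  by move=> /le_trans; apply; rewrite ler_nat.
- by move=> i; exact: measurable_itv.
- by rewrite bigcup_symm_itv; exact: continuous_measurable_fun.
- by move=> x; rewrite invr_ge0 sqr_ge0.
- move=> i; rewrite EFin_Rintegral_itv; last exact: continuous_subspaceT.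
  have ii : - i%:R <= i%:R :> R by rewrite ge0_cp.
  rewrite (Rintegral_primitive ii (@is_derive_atan_jap R) cf) lee_fin.
  by rewrite atanN; have := @atan_ltpi2 R i%:R; lra.
Qed.

Lemma is_derive_sqrt_primitive y : 0 < y ->
  is_derive y 1 (fun t : R => 2 * atan (Num.sqrt t)) (rho y).
Proof.
move=> y0; have s0 : 0 < Num.sqrt y by rewrite sqrtr_gt0.
have h := is_derive1_sqrt y0.
have h2 := is_derive_comp (is_derive1_atan (Num.sqrt y)) h.
apply: is_derive_eq; rewrite /GRing.scale/= /rho gtr0_norm// sqr_sqrtr ?ltW//.
have y1 : 1 + y != 0 by rewrite gt_eqF// addr_gt0.
by have := lt0r_neq0 s0; move=> s1; field; rewrite s1 y1.
Qed.

Lemma rhoN y : rho (- y) = rho y.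
Proof. by rewrite /rho normrN. Qed.

Lemma rho0 : rho 0 = 0 :> R.
Proof. by rewrite /rho normr0 sqrtr0 mul0r invr0. Qed.

Lemma continuous_rho y : y != 0 -> {for y, continuous (@rho R)}.
Proof.
move=> y0; apply: continuousV.
  by rewrite mulf_neq0// ?gt_eqF ?sqrtr_gt0 ?normr_gt0// ltr_pwDl.
apply: (@continuous_mul _ (fun y : R => Num.sqrt `|y|) (fun y : R => 1 + `|y|)).
  exact: (continuous_compose (@sqrt_continuous R) continuous_norm).
by apply: continuous_add; [exact: continuous_const|exact: continuous_norm].
Qed.

Lemma integral_rho_itv_le a b : 0 < a -> a <= b ->
  (\int[mu]_(x in `[a, b]) (rho x)%:E <= pi%:E)%E.
Proof.
move=> a0; rewrite le_eqVlt => /predU1P[<-|ab].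
  by rewrite set_itv1 integral_set1 lee_fin pi_ge0.
have b0 := lt_trans a0 ab.
have cF c : 0 < c -> {for c, continuous (fun t : R => 2 * atan (Num.sqrt t))}.
  move=> c0; apply: differentiable_continuous; apply/derivable1_diffP.
  by have [] := is_derive_sqrt_primitive c0.
rewrite (@continuous_FTC2 _ _ (fun t : R => 2 * atan (Num.sqrt t)))//.
- rewrite -EFinB lee_fin.
  have := @atan_ltpi2 R (Num.sqrt b).
  have : 0 <= atan (Num.sqrt a) by rewrite -atan0 le_atan// sqrtr_ge0.
  lra.
- apply: continuous_in_subspaceT => x; rewrite inE/= in_itv/= => /andP[ax _].
  by apply: continuous_rho; rewrite gt_eqF// (lt_le_trans a0).
- split.
  + by move=> x; rewrite in_itv/= => /andP[ax _]; have [] := is_derive_sqrt_primitive (lt_trans a0 ax).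
  + exact: cvg_at_right_filter (cF a a0).
  + exact: cvg_at_left_filter (cF b b0).
- move=> x; rewrite in_itv/= => /andP[ax _]; rewrite derive1E.
  by have := is_derive_sqrt_primitive (lt_trans a0 ax); move=> h; exact: derive_val.
Qed.

Lemma integrable_rho : mu.-integrable setT (EFin \o @rho R).
Proof.
pose E i := (`[- i.+1%:R, - i.+1%:R^-1] `|` `[i.+1%:R^-1, i.+1%:R])%classic : set R.
have i0 i : 0 < i.+1%:R^-1 :> R by rewrite invr_gt0.
have ile i : i.+1%:R^-1 <= i.+1%:R :> R.
  by apply: (@le_trans _ _ 1); rewrite ?invf_le1 ?ler1n.
have EP i x : E i x <-> i.+1%:R^-1 <= `|x| <= i.+1%:R.
  rewrite /E /= !in_itv/=; have := i0 i; have := ile i.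
  set u := i.+1%:R^-1; set v := i.+1%:R => uv u0.
  have [x0|x0] := ger0P x; split.
  - by case=> /andP[h1 h2]; apply/andP; split; lra.
  - by right.
  - by case=> /andP[h1 h2]; apply/andP; split; lra.
  - by move=> /andP[h1 h2]; left; apply/andP; split; lra.
have UE : \bigcup_i E i = ~` [set 0].
  apply/seteqP; split=> x.
    move=> [i _ /EP/andP[h _]] /= x0; move: h; rewrite x0 normr0 leNgt.
    by rewrite i0.
  move=> /= /eqP x0; have ax : 0 < `|x| by rewrite normr_gt0.
  exists (maxn (Num.truncn `|x|).+1 (Num.truncn `|x|^-1).+1) => //; apply/EP.
  set m := maxn _ _.
  have h1 : `|x| <= m.+1%:R.
    apply: le_trans (ltW (truncnS_gt _)) _; rewrite ler_nat.
    by rewrite (leq_trans (leq_maxl _ _) (leqnSn _)).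
  have h2 : `|x|^-1 <= m.+1%:R.
    apply: le_trans (ltW (truncnS_gt _)) _; rewrite ler_nat.
    by rewrite (leq_trans (leq_maxr _ _) (leqnSn _)).
  by rewrite h1 andbT -[leRHS]invrK lef_pV2// posrE ?invr_gt0.
have oD : open (~` [set 0] : set R).
  by apply: closed_openC; exact: closed_eq.
have mD : measurable (~` [set 0] : set R) by exact: open_measurable.
have mrho : measurable_fun (~` [set 0] : set R) (@rho R).
  apply: open_continuous_measurable_fun => //.
  by move=> x; rewrite inE/= => /eqP x0; exact: continuous_rho.
have h : mu.-integrable (\bigcup_i E i) (EFin \o @rho R).
  apply: (@integrable_bigcup_le R _ _ (2 * pi)).
  - move=> i j ij; apply/subsetPset => x /EP /andP[h1 h2]; apply/EP.
    apply/andP; split; last by rewrite (le_trans h2)// ler_nat.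
    by apply: le_trans h1; rewrite lef_pV2 ?posrE// ler_nat.
  - by move=> i; apply: measurableU; exact: measurable_itv.
  - by rewrite UE.
  - exact: rho_ge0.
  - move=> i; rewrite ge0_integral_setU//=.
    + rewrite integration_by_substitution_oppr//.
        under eq_integral do rewrite /= rhoN.
        have := integral_rho_itv_le (i0 i) (ile i).
        move=> h; apply: le_trans (leeD h h) _.
        by rewrite -EFinD lee_fin mulr2n mulrDl !mul1r.
      apply: continuous_in_subspaceT => x; rewrite inE/= in_itv/= => /andP[_ x1].
      by apply: continuous_rho; rewrite lt_eqF// (le_lt_trans x1)// oppr_lt0.
    + apply/measurable_EFinP; apply: measurable_funS mrho => //.
      by move=> x Ex; rewrite -UE; exists i.
    + by move=> x _; rewrite lee_fin rho_ge0.
    + apply/disj_setPS => x [/=]; rewrite !in_itv/= => /andP[_ x1] /andP[x2 _].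
      have : - i.+1%:R^-1 < i.+1%:R^-1 :> R by rewrite gtrN.
      by rewrite ltNge (le_trans x2 x1).
rewrite UE in h.
suff <- : (EFin \o @rho R) \_ (~` [set 0]) = EFin \o @rho R.
  have mD' : measurable (~` [set 0] : set (measurableTypeR R)) by exact: mD.
  by have := (@integrable_mkcond _ _ R mu _ (EFin \o @rho R) mD').1 h.
apply/funext => x; rewrite patchE; case: ifPn => //.
rewrite notin_setE/= => /contrapT ->.
by rewrite rho0.
Qed.

Lemma amp_le_itv d s : 0 < d -> d <= 1 -> amp d s <= d^-1 * (jap 1 s ^+ 2)^-1.
Proof.
move=> d0 d1; have j1 := jap_gt0 1 s; have j2 := jap_gt0 d s.
rewrite /amp expr2 invfM mulrCA; apply: ler_wpM2l; first by rewrite invr_ge0 ltW.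
rewrite -invfM lef_pV2 ?posrE ?mulr_gt0//.
rewrite -(@ler_pXn2r _ 2) ?nnegrE ?mulr_ge0 ?(ltW j1) ?(ltW j2) ?(ltW d0)//.
rewrite exprMn !sqr_jap mul1r exprMn mulrDr mulr1 lerD2r.
by rewrite expr_le1// ltW.
Qed.

Lemma integrable_osc n la d al p : 0 < d -> d <= 1 -> continuous p ->
  mu.-integrable setT (EFin \o osc n la d al p).
Proof.
move=> d0 d1 cp.
apply: (@le_integrable_real R _ _ (fun s => d^-1 * (jap 1 s ^+ 2)^-1)) => //.
- by apply: continuous_measurable_fun; exact: continuous_osc.
- by move=> s _; apply: le_trans (norm_osc_le _ _ _ _ _ _) (amp_le_itv _ d0 d1).
- have := @integrableZl _ _ R mu setT measurableT d^-1 _ integrable_invr_sqr_jap.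
  by apply: eq_integrable => // x _.
Qed.

End Integrability.

(** * The limit of the oscillatory integrals *)

Section FullLine.
Context {R : realType}.
Implicit Types (a b d n la al w x y s t M N T : R) (p : R -> R).
Notation mu := (@lebesgue_measure R).

Section Uniform.
Variables (n la d al w : R) (p : R -> R).
Hypothesis dp : forall s, is_derive s 1 p (w / jap d s ^+ 2).
Hypothesis d01 : 0 <= d <= 1.
Let C := osc_cst n la.
Let cp : continuous p := is_derive_continuous dp.

Lemma osc_trunc_sub_le M N : 0 < M -> M <= N ->
  `|w| * `|\int[mu]_(s in `[- N, N]) osc n la d al p s -
           \int[mu]_(s in `[- M, M]) osc n la d al p s| <=
  2 * (2 + C) * (M^-1 + d).
Proof.
move=> M0 MN.
have co := @continuous_osc R n la d al p cp.
rewrite (@Rintegral_itv_split _ _ _ (- M)) ?lerN2//; last lra.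
rewrite (@Rintegral_itv_split _ _ (- M) M)//; last lra.
have [h1 h2] := osc_tails_le n la al dp d01 M0 MN.
rewrite (_ : _ + (_ + _) - _ = \int[mu]_(s in `[- N, - M]) osc n la d al p s +
  \int[mu]_(s in `[M, N]) osc n la d al p s); last by ring.
have h := ler_wpM2l (normr_ge0 w) (ler_normD
  (\int[mu]_(s in `[- N, - M]) osc n la d al p s)
  (\int[mu]_(s in `[M, N]) osc n la d al p s)).
apply: le_trans h _; rewrite mulrDr -[2 * _ * _]mulrA mulr2n mulrDl !mul1r.
exact: lerD.
Qed.

Hypothesis d0 : 0 < d.

Lemma cvg_osc_trunc :
  \int[mu]_(s in `[- k%:R, k%:R]) osc n la d al p s @[k --> \oo] -->
  \int[mu]_s osc n la d al p s.
Proof.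
by apply: cvg_Rintegral_symm_itv; apply: integrable_osc => //; case/andP: d01.
Qed.

Lemma osc_full_sub_le M : 0 < M ->
  `|w| * `|\int[mu]_s osc n la d al p s -
           \int[mu]_(s in `[- M, M]) osc n la d al p s| <=
  2 * (2 + C) * (M^-1 + d).
Proof.
move=> M0.
have h : `|w| * `|\int[mu]_(s in `[- k%:R, k%:R]) osc n la d al p s -
           \int[mu]_(s in `[- M, M]) osc n la d al p s| @[k --> \oo] -->
   `|w| * `|\int[mu]_s osc n la d al p s -
           \int[mu]_(s in `[- M, M]) osc n la d al p s|.
  apply: cvgM; first exact: cvg_cst.
  by apply: cvg_norm; apply: cvgB; [exact: cvg_osc_trunc|exact: cvg_cst].
apply: (cvgr_to_le h); near=> k; apply: osc_trunc_sub_le => //.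
by near: k; exact: nbhs_infty_ger.
Unshelve. all: by end_near. Qed.

Lemma sqr_osc_full_le y : y != 0 -> `|w - (1 + d ^+ 2) * y| <= 2 * d ->
  (\int[mu]_s osc n la d al p s) ^+ 2 <= osc_bound n la * rho y.
Proof.
move=> y0 wy.
have h : (\int[mu]_(s in `[- k%:R, k%:R]) osc n la d al p s) ^+ 2 @[k --> \oo] -->
   (\int[mu]_s osc n la d al p s) ^+ 2.
  by rewrite expr2; under eq_fun do rewrite expr2; apply: cvgM; exact: cvg_osc_trunc.
apply: (cvgr_to_le h); near=> k; apply: (sqr_osc_le _ _ _ dp) => //.
by near: k; exact: nbhs_infty_gtr.
Unshelve. all: by end_near. Qed.

End Uniform.

Lemma is_derive_linear_jap0 y s : is_derive s 1 (fun t : R => y * t) (y / jap 0 s ^+ 2).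
Proof. by rewrite jap0 expr1n divr1; apply: is_derive_eq; rewrite /GRing.scale/= mulr1. Qed.

Definition trunc_ft n la al y N : R :=
  \int[mu]_(s in `[- N, N]) osc n la 0 al (fun t => y * t) s.

Definition lim_ft n la al y : R := lim (trunc_ft n la al y k%:R @[k --> \oo]).

Lemma trunc_ft_sub_le n la al y M N : 0 < M -> M <= N ->
  `|y| * `|trunc_ft n la al y N - trunc_ft n la al y M| <=
    2 * (2 + osc_cst n la) * M^-1.
Proof.
move=> M0 MN; rewrite -[M^-1]addr0.
by apply: (osc_trunc_sub_le _ _ _ (is_derive_linear_jap0 y)); rewrite ?lexx ?ler01.
Qed.

Lemma cvg_trunc_ft n la al y : y != 0 ->
  trunc_ft n la al y k%:R @[k --> \oo] --> lim_ft n la al y.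
Proof.
move=> y0; have ay : 0 < `|y| by rewrite normr_gt0.
set c := 2 * (2 + osc_cst n la).
have c0 : 0 < c by have := osc_cst_ge0 n la; rewrite /c; lra.
apply: cauchy_cvg; apply/cauchy_exP => e e0.
pose M := (Num.truncn (c / (`|y| * e))).+1.
exists (trunc_ft n la al y M%:R).
suff : \forall k \near \oo, ball (trunc_ft n la al y M%:R) e (trunc_ft n la al y k%:R).
  by [].
near=> k.
rewrite /ball/= -(ltr_pM2l ay).
have M0 : 0 < M%:R :> R by rewrite ltr0n.
have Mk : M%:R <= k%:R :> R by near: k; exact: nbhs_infty_ger.
rewrite distrC; apply: le_lt_trans (trunc_ft_sub_le n la al y M0 Mk) _.
rewrite -/c ltr_pdivrMr// mulrC -ltr_pdivrMr ?mulr_gt0//.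
exact: truncnS_gt.
Unshelve. all: by end_near. Qed.

Lemma lim_ft_sub_le n la al y M : y != 0 -> 0 < M ->
  `|y| * `|lim_ft n la al y - trunc_ft n la al y M| <= 2 * (2 + osc_cst n la) * M^-1.
Proof.
move=> y0 M0.
have h : `|y| * `|trunc_ft n la al y k%:R - trunc_ft n la al y M| @[k --> \oo] -->
   `|y| * `|lim_ft n la al y - trunc_ft n la al y M|.
  apply: cvgM; first exact: cvg_cst.
  by apply: cvg_norm; apply: cvgB; [exact: cvg_trunc_ft|exact: cvg_cst].
apply: (cvgr_to_le h); near=> k; apply: trunc_ft_sub_le => //.
by near: k; exact: nbhs_infty_ger.
Unshelve. all: by end_near. Qed.

Lemma sqr_trunc_ft_le n la al y N : y != 0 -> 0 < N ->
  trunc_ft n la al y N ^+ 2 <= osc_bound n la * rho y.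
Proof.
move=> y0 N0; apply: (sqr_osc_le _ _ _ (is_derive_linear_jap0 y)) => //.
  by rewrite lexx ler01.
by rewrite expr0n addr0 mul1r subrr normr0 mulr0.
Qed.

Lemma cvg_osc_itv n la al y M (d_ al_ : nat -> R) (p_ : nat -> R -> R) :
  (forall k, continuous (p_ k)) ->
  d_ k @[k --> \oo] --> 0 -> al_ k @[k --> \oo] --> al ->
  (forall s, p_ k s @[k --> \oo] --> y * s) ->
  \int[mu]_(s in `[- M, M]) osc n la (d_ k) (al_ k) (p_ k) s @[k --> \oo] -->
    trunc_ft n la al y M.
Proof.
move=> cp cd cal cvp.
have mf k : measurable_fun (`[- M, M] : set R) (osc n la (d_ k) (al_ k) (p_ k)).
  apply: measurable_funTS; apply: continuous_measurable_fun.
  exact: continuous_osc.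
have cvds s : 1 + (d_ k * s) ^+ 2 @[k --> \oo] --> 1 + (0 * s) ^+ 2.
  apply: cvgD; first exact: cvg_cst.
  rewrite expr2; under eq_fun do rewrite expr2.
  by apply: cvgM; apply: cvgM => //; exact: cvg_cst.
have cvj s : jap (d_ k) s @[k --> \oo] --> jap 0 s.
  by apply: (cvg_comp _ _ (cvds s)); exact: sqrt_continuous.
have cvln s : ln (1 + (d_ k * s) ^+ 2) @[k --> \oo] --> ln (1 + (0 * s) ^+ 2).
  by apply: (cvg_comp _ _ (cvds s)); apply: continuous_ln; exact: one_add_sqr_gt0.
have cvo s : (`[- M, M]%classic : set R) s ->
    osc n la (d_ k) (al_ k) (p_ k) s @[k --> \oo] -->
    osc n la 0 al (fun t => y * t) s.
  move=> _; apply: cvgM.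
    apply: cvgM; first exact: cvg_cst.
    by apply: cvgV; [exact: jap_neq0|exact: cvj].
  apply: (@cvg_comp _ _ _ (fun k => al_ k + phase n la (d_ k) s - p_ k s) cos);
    last exact: continuous_cos.
  apply: cvgB => //; apply: cvgD => //; apply: cvgB; first exact: cvg_cst.
  apply: cvgM; first exact: cvg_cst.
  by apply: cvgB; [exact: cvln|exact: cvg_cst].
have le k s : (`[- M, M]%classic : set R) s ->
    `|osc n la (d_ k) (al_ k) (p_ k) s| <= 1.
  move=> _; apply: le_trans (norm_osc_le _ _ _ _ _ _) _.
  by apply: le_trans (amp_le _ _) _; rewrite invf_le1 ?jap_gt0// jap_ge1.
have i1 := @integrable_continuous_itv R (fun=> 1) (- M) M (@continuous_const R 1).
by have [] := @dominated_cvg_real R `[- M, M]%classic _ _ (fun=> 1)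
  (measurable_itv _) mf cvo i1 le.
Qed.

Lemma cvg_osc_full n la al y (d_ al_ w_ : nat -> R) (p_ : nat -> R -> R) :
  (forall k s, is_derive s 1 (p_ k) (w_ k / jap (d_ k) s ^+ 2)) ->
  (forall k, 0 < d_ k <= 1) -> y != 0 ->
  (forall k, `|w_ k - (1 + d_ k ^+ 2) * y| <= 2 * d_ k) ->
  d_ k @[k --> \oo] --> 0 -> al_ k @[k --> \oo] --> al ->
  (forall s, p_ k s @[k --> \oo] --> y * s) ->
  \int[mu]_s osc n la (d_ k) (al_ k) (p_ k) s @[k --> \oo] --> lim_ft n la al y.
Proof.
move=> dp d01 y0 wy cd cal cvp; have ay : 0 < `|y| by rewrite normr_gt0.
set c := 2 * (2 + osc_cst n la) * (2 / `|y|).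
have c0 : 0 < c.
  by rewrite mulr_gt0 ?divr_gt0//; have := osc_cst_ge0 n la; lra.
have cp k := is_derive_continuous (dp k).
apply/cvgrPdist_le => e e0.
pose M := 4 * c / e.
have M0 : 0 < M by rewrite divr_gt0// mulr_gt0.
have MV : c * M^-1 = e / 4.
  by rewrite /M; field; rewrite !gt_eqF.
have cM := @cvg_osc_itv n la al y M d_ al_ p_ cp cd cal cvp.
near=> k.
have /andP[dk0 dk1] := d01 k.
have dk01 : 0 <= d_ k <= 1 by rewrite (ltW dk0).
have h1 : `|lim_ft n la al y - trunc_ft n la al y M| <= e / 4.
  have := lim_ft_sub_le n la al y0 M0; rewrite -ler_pdivlMl// => /le_trans; apply.
  have e1 : 0 <= e / 4 by lra.
  have -> : `|y|^-1 * (2 * (2 + osc_cst n la) / M) = (e / 4) / 2.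
    by rewrite -MV /c; field; rewrite !gt_eqF.
  lra.
have h2 : `|trunc_ft n la al y M -
   \int[mu]_(s in `[- M, M]) osc n la (d_ k) (al_ k) (p_ k) s| <= e / 4.
  by near: k; move/cvgrPdist_le : cM; apply; lra.
have dy : 4 * d_ k <= `|y|.
  rewrite -ler_pdivlMl//; have : `|0 - d_ k| <= 4^-1 * `|y|.
    by near: k; move/cvgrPdist_le : cd; apply; rewrite mulr_gt0.
  by rewrite sub0r normrN gtr0_norm.
have cde : c * d_ k <= e / 4.
  rewrite -ler_pdivlMl//; have : `|0 - d_ k| <= c^-1 * (e / 4).
    by near: k; move/cvgrPdist_le : cd; apply; rewrite mulr_gt0 ?invr_gt0// divr_gt0.
  by rewrite sub0r normrN gtr0_norm.
have w2 := freq_ge dk01 (wy k) dy.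
have h3 : `|\int[mu]_(s in `[- M, M]) osc n la (d_ k) (al_ k) (p_ k) s -
   \int[mu]_s osc n la (d_ k) (al_ k) (p_ k) s| <= e / 2.
  have := @osc_full_sub_le n la (d_ k) (al_ k) (w_ k) (p_ k) (dp k) dk01 dk0 M M0.
  rewrite distrC => h.
  have {}h := le_trans (ler_wpM2r (normr_ge0 _) w2) h.
  move: h; rewrite -ler_pdivlMl ?divr_gt0// => /le_trans; apply.
  have -> : (`|y| / 2)^-1 * (2 * (2 + osc_cst n la) * (M^-1 + d_ k)) =
     c * M^-1 + c * d_ k by rewrite /c; field; rewrite !gt_eqF.
  by rewrite MV; lra.
have := ler_distD (trunc_ft n la al y M) (lim_ft n la al y)
  (\int[mu]_s osc n la (d_ k) (al_ k) (p_ k) s).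
have := ler_distD (\int[mu]_(s in `[- M, M]) osc n la (d_ k) (al_ k) (p_ k) s)
  (trunc_ft n la al y M)
  (\int[mu]_s osc n la (d_ k) (al_ k) (p_ k) s).
lra.
Unshelve. all: by end_near. Qed.

End FullLine.

(** * L^2 convergence *)

Section SeqCont.
Context {R : realType}.

Lemma seq_continuous (f : R -> R) :
  (forall (u : nat -> R) x, u k @[k --> \oo] --> x -> f (u k) @[k --> \oo] --> f x) ->
  continuous f.
Proof.
move=> h x; apply/continuous_withinNx; apply/cvgr_dnbhsP => u [_ ux].
exact: h.
Qed.
End SeqCont.

Section Norm.
Context {R : realType}.
Notation mu := (@lebesgue_measure R).
Implicit Types (f g : R -> R[i]).

Definition sqnorm f (t : R) : R := complex.Re (f t) ^+ 2 + complex.Im (f t) ^+ 2.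

Lemma sqnorm_ge0 f t : 0 <= sqnorm f t.
Proof. by rewrite addr_ge0// sqr_ge0. Qed.

Lemma sqr_absc (z : R[i]) : absc z ^+ 2 = complex.Re z ^+ 2 + complex.Im z ^+ 2.
Proof.
by case: z => a b; rewrite /absc normc_def/= sqr_sqrtr// addr_ge0// sqr_ge0.
Qed.

Lemma norm2E f : norm2 f = ((\int[mu]_t (sqnorm f t)%:E) `^ 2^-1)%E.
Proof.
rewrite /norm2 unlock; congr (_ `^ _)%E; apply: eq_integral => t _.
rewrite abse_EFin poweR_EFin powR_mulrn// real_normK ?num_real//.
by rewrite sqr_absc.
Qed.

Lemma measurable_sqnorm f : cmeasurable f -> measurable_fun setT (sqnorm f).
Proof. by move=> [h1 h2]; apply: measurable_funD; apply: measurable_funX. Qed.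

Lemma norm2_sqr f : (norm2 f * norm2 f = \int[mu]_t (sqnorm f t)%:E)%E.
Proof.
have h : (0 <= \int[mu]_t (sqnorm f t)%:E)%E.
  by apply: integral_ge0 => t _; rewrite lee_fin sqnorm_ge0.
rewrite norm2E; move: h; case: (\int[mu]_t _)%E => [r| |//].
  rewrite lee_fin => r0.
  by rewrite poweR_EFin powR12_sqrt// -EFinM -expr2 sqr_sqrtr.
by rewrite poweRyr ?mulyy// invr_eq0.
Qed.

Lemma norm2_fin f : (norm2 f < +oo)%E <-> (\int[mu]_t (sqnorm f t)%:E < +oo)%E.
Proof.
split=> h; last by rewrite norm2E; exact: poweR_lty.
rewrite -norm2_sqr; apply: lte_mul_pinfty => //; first exact: Lnorm_ge0.
by rewrite ge0_fin_numE// Lnorm_ge0.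
Qed.

Lemma inL2P f : inL2 f <-> cmeasurable f /\ mu.-integrable setT (EFin \o sqnorm f).
Proof.
split=> -[mf h]; split=> //.
  apply/integrableP; split; first by apply/measurable_EFinP; exact: measurable_sqnorm.
  move/norm2_fin : h; congr (_ < _)%E; apply: eq_integral => t _.
  by rewrite /= ger0_norm// sqnorm_ge0.
apply/norm2_fin; move/integrableP : h => [_]; congr (_ < _)%E.
by apply: eq_integral => t _; rewrite /= ger0_norm// sqnorm_ge0.
Qed.

Lemma norm2_cvg0 (I : Type) (F : set_system I) (FF : Filter F) (f : I -> R -> R[i]) :
  (\int[mu]_t (sqnorm (f i) t)%:E @[i --> F] --> 0)%E ->
  (norm2 (f i) @[i --> F] --> 0)%E.
Proof.
move=> h.
have h0 i : (0 <= \int[mu]_t (sqnorm (f i) t)%:E)%E.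
  by apply: integral_ge0 => t _; rewrite lee_fin sqnorm_ge0.
have [hf hc] := (fine_cvgP _ _).1 h.
apply/fine_cvgP; split.
  apply: filterS hf => i hi; rewrite norm2E -(fineK hi) poweR_EFin.
  by [].
apply/cvgrPdist_le => e e0.
have e20 : 0 < e ^+ 2 by rewrite exprn_gt0.
move/cvgrPdist_le : hc => /(_ _ e20) hc.
apply: filterS2 hf hc => i hi; rewrite /= !sub0r !normrN norm2E -{2}(fineK hi).
have fi0 : 0 <= fine (\int[mu]_t (sqnorm (f i) t)%:E) by exact: fine_ge0.
rewrite poweR_EFin powR12_sqrt//= (ger0_norm fi0) ger0_norm ?sqrtr_ge0// => hle.
by rewrite -[e]ger0_norm ?(ltW e0)// -sqrtr_sqr ler_wsqrtr.
Qed.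

Lemma cvg0_norm2 (I : Type) (F : set_system I) (FF : Filter F) (f : I -> R -> R[i]) :
  (norm2 (f i) @[i --> F] --> 0)%E ->
  (\int[mu]_t (sqnorm (f i) t)%:E @[i --> F] --> 0)%E.
Proof.
move=> h; have h2 : (norm2 (f i) * norm2 (f i) @[i --> F] --> 0 * 0)%E.
  by apply: cvgeM.
rewrite mule0 in h2; rewrite (_ : (fun i => _) = (fun i => norm2 (f i) * norm2 (f i))%E)//.
by apply/funext => i; rewrite norm2_sqr.
Qed.

Lemma cvg_Rintegral_sqnorm (f : nat -> R -> R[i]) g : cvgL2 \oo f g ->
  \int[mu]_t sqnorm (fun t => f k t - g t) t @[k --> \oo] --> 0.
Proof. by case=> _ _ /cvg0_norm2 /fine_cvgP[]. Qed.

End Norm.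

Section L2Convergence.
Context {R : realType}.
Notation mu := (@lebesgue_measure R).
Notation D := (~` [set 0%R] : set (measurableTypeR R)).

Lemma measurable_fun_restr (A : set (measurableTypeR R)) (f : R -> R) :
  measurable_fun setT f -> measurable_fun A f.
Proof. by move=> mf; apply: (@measurable_funTS _ _ (measurableTypeR R) _ A f); exact: mf. Qed.

Lemma lebesgue_integral_setD0 (f : R -> \bar R) : measurable_fun setT f ->
  (forall x, 0 <= f x)%E -> (\int[mu]_x f x = \int[mu]_(x in D) f x)%E.
Proof.
move=> mf f0; rewrite (@ge0_negligible_integral _ _ _ mu setT [set 0%R])//.
- by rewrite setTD.
- exact: lebesgue_measure_set1.
Qed.

Lemma measurable_D : measurable D.
Proof. exact: measurableC. Qed.

Lemma measurable_patch_D (f : R -> R) : measurable_fun D f -> measurable_fun setT (f \_ D).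
Proof. by move=> mf; apply/(measurable_restrictT f) => //; exact: measurable_D. Qed.

(* The bounds and the limits hold away from [y = 0] only, so the limits are set to
   0 there. *)
Lemma dominated_cvg_sqr (u v : nat -> R -> R) (a b : R -> R) (K : R) :
  (forall k, measurable_fun setT (u k)) -> (forall k, measurable_fun setT (v k)) ->
  (forall y, y != 0 -> u k y @[k --> \oo] --> a y) ->
  (forall y, y != 0 -> v k y @[k --> \oo] --> b y) ->
  (forall k y, y != 0 -> u k y ^+ 2 <= K * rho y) ->
  (forall k y, y != 0 -> v k y ^+ 2 <= K * rho y) ->
  (\int[mu]_y ((u k y - (a \_ D) y) ^+ 2 + (v k y - (b \_ D) y) ^+ 2)%:E
     @[k --> \oo] --> 0)%E.
Proof.
move=> mu_ mv cu cv uK vK.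
have ma : measurable_fun D a.
  apply: (@measurable_fun_cvg _ _ R D u a) => [k|y /eqP y0]; last exact: cu.
  exact: measurable_fun_restr.
have mb : measurable_fun D b.
  apply: (@measurable_fun_cvg _ _ R D v b) => [k|y /eqP y0]; last exact: cv.
  exact: measurable_fun_restr.
have mpa := measurable_patch_D ma; have mpb := measurable_patch_D mb.
pose G k y := (u k y - (a \_ D) y) ^+ 2 + (v k y - (b \_ D) y) ^+ 2.
have mG k : measurable_fun setT (G k).
  by apply: measurable_funD; apply: measurable_funX; apply: measurable_funB.
have patchD (f : R -> R) y : D y -> (f \_ D) y = f y by move=> Dy; rewrite patchE mem_set.
have cG y : D y -> G k y @[k --> \oo] --> (0 : R).
  move=> Dy; have /eqP y0 := Dy.
  rewrite -[X in _ --> X](_ : (a y - (a \_ D) y) ^+ 2 + (b y - (b \_ D) y) ^+ 2 = _).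
    by apply: cvgD; rewrite expr2; under eq_fun do rewrite expr2;
       apply: cvgM; apply: cvgB; [exact: cu|exact: cvg_cst|exact: cu|exact: cvg_cst
         |exact: cv|exact: cvg_cst|exact: cv|exact: cvg_cst].
  by rewrite !patchD// !subrr expr0n addr0.
have sqr2 (x y z : R) : x ^+ 2 <= z -> y ^+ 2 <= z -> (x - y) ^+ 2 <= 4 * z.
  move=> h1 h2; have := sqr_ge0 (x + y); rewrite sqrrD sqrrB; lra.
have leG k y : D y -> `|G k y| <= 8 * K * rho y.
  move=> Dy; have /eqP y0 := Dy.
  rewrite ger0_norm ?addr_ge0 ?sqr_ge0// /G !patchD//.
  have ay : a y ^+ 2 <= K * rho y.
    have h : u k y ^+ 2 @[k --> \oo] --> a y ^+ 2.
      by rewrite expr2; under eq_fun do rewrite expr2; apply: cvgM; exact: cu.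
    by apply: (cvgr_to_le h); near=> j; exact: uK.
  have by_ : b y ^+ 2 <= K * rho y.
    have h : v k y ^+ 2 @[k --> \oo] --> b y ^+ 2.
      by rewrite expr2; under eq_fun do rewrite expr2; apply: cvgM; exact: cv.
    by apply: (cvgr_to_le h); near=> j; exact: vK.
  have := sqr2 _ _ _ (uK k y y0) ay; have := sqr2 _ _ _ (vK k y y0) by_; lra.
have irho : mu.-integrable D (EFin \o (fun y => 8 * K * rho y)).
  have h := @integrable_rho R.
  have := @integrableZl _ _ R mu setT measurableT (8 * K) _ h.
  by move/integrableS; apply => //; exact: measurable_D.
have mGD k : measurable_fun D (G k) by exact: measurable_fun_restr.
have [i0 c0] := @dominated_cvg_real R D G (fun=> 0) _ measurable_D mGD cG irho leG.
have iG k : mu.-integrable D (EFin \o G k).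
  exact: (le_integrable_real measurable_D (mGD k) (leG k) irho).
have -> : (fun k => \int[mu]_y ((u k y - (a \_ D) y) ^+ 2 +
    (v k y - (b \_ D) y) ^+ 2)%:E)%E = EFin \o (fun k => \int[mu]_(y in D) G k y).
  apply/funext => k; rewrite /= lebesgue_integral_setD0; last 2 first.
  - by apply/measurable_EFinP; exact: mG.
  - by move=> x; rewrite lee_fin addr_ge0// sqr_ge0.
  rewrite /Rintegral fineK//.
  by apply: integrable_fin_num; [exact: measurable_D|exact: iG].
apply: cvg_EFin; first exact: nearW.
by move: c0; rewrite Rintegral_cst ?mul0r; last exact: measurable_D.
Unshelve. all: by end_near. Qed.

End L2Convergence.

(** * Uniqueness of the L^2 Fourier transform *)

Section Pairing.
Context {R : realType}.
Notation mu := (@lebesgue_measure R).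

Definition real_L2 (f : R -> R) : Prop :=
  measurable_fun setT f /\ mu.-integrable setT (EFin \o (fun t => f t ^+ 2)).

Lemma integrable_mul_L2 (f g : R -> R) : real_L2 f -> real_L2 g ->
  mu.-integrable setT (EFin \o (fun t => f t * g t)).
Proof.
move=> [mf fi] [mg gi].
apply: (@le_integrable_real R _ _ (fun t => f t ^+ 2 + g t ^+ 2)) => //.
- exact: measurable_funM.
- move=> t _; rewrite normrM -[f t ^+ 2]real_normK ?num_real//.
  rewrite -[g t ^+ 2]real_normK ?num_real//.
  move: `|f t| `|g t| (normr_ge0 (f t)) (normr_ge0 (g t)) => a b a0 b0.
  have := sqr_ge0 (a - b); rewrite sqrrB; have := mulr_ge0 a0 b0; lra.
- have := @integrableD _ _ R mu setT measurableT _ _ fi gi.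
  by apply: eq_integrable.
Qed.

Lemma real_L2B (f g : R -> R) : real_L2 f -> real_L2 g ->
  real_L2 (fun t => f t - g t).
Proof.
move=> [mf fi] [mg gi]; have mfg : measurable_fun setT (fun t => f t - g t).
  exact: measurable_funB.
split=> //.
apply: (@le_integrable_real R _ _ (fun t => 2 * (f t ^+ 2 + g t ^+ 2))) => //.
- by apply: (measurable_funX 2); exact: mfg.
- move=> t _; rewrite ger0_norm ?sqr_ge0//.
  by have := sqr_ge0 (f t + g t); rewrite sqrrB sqrrD; lra.
- have h := @integrableD _ _ R mu setT measurableT _ _ fi gi.
  have := @integrableZl _ _ R mu setT measurableT 2 _ h.
  by apply: eq_integrable.
Qed.

(* Instead of Cauchy-Schwarz: [|a b| <= r/2 a^2 + 1/(2 r) b^2] for all [r > 0]. *)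
Lemma cvg_pairing (f_ : nat -> R -> R) (f g : R -> R) :
  (\forall k \near \oo, real_L2 (f_ k)) -> real_L2 f -> real_L2 g ->
  \int[mu]_t ((f_ k t - f t) ^+ 2) @[k --> \oo] --> (0 : R) ->
  \int[mu]_t (f_ k t * g t) @[k --> \oo] --> \int[mu]_t (f t * g t).
Proof.
move=> L2f_ L2f L2g cf.
set A := \int[mu]_t (g t ^+ 2).
have A0 : 0 <= A by apply: Rintegral_ge0 => t _; exact: sqr_ge0.
apply/cvgrPdist_le => e e0; pose r := (A + 1) / e.
have r0 : 0 < r by rewrite divr_gt0//; lra.
near=> k.
have L2k : real_L2 (f_ k) by near: k.
have L2d := real_L2B L2k L2f.
have small : \int[mu]_t ((f_ k t - f t) ^+ 2) <= e / r.
  have : `|0 - \int[mu]_t ((f_ k t - f t) ^+ 2)| <= e / r.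
    by near: k; move/cvgrPdist_le : cf; apply; rewrite divr_gt0.
  by rewrite sub0r normrN; apply: le_trans; exact: ler_norm.
have ik := integrable_mul_L2 L2k L2g; have i0 := integrable_mul_L2 L2f L2g.
have id := integrable_mul_L2 L2d L2g.
rewrite distrC -RintegralB//.
have -> : \int[mu]_x (f_ k x * g x - f x * g x) = \int[mu]_x ((f_ k x - f x) * g x).
  by apply: eq_Rintegral => x _; rewrite mulrBl.
apply: le_trans (le_normr_Rintegral _ id) _ => //.
have ib1 : mu.-integrable setT (EFin \o (fun t => r / 2 * (f_ k t - f t) ^+ 2)).
  have := @integrableZl _ _ R mu setT measurableT (r / 2) _ L2d.2.
  by apply: eq_integrable.
have ib2 : mu.-integrable setT (EFin \o (fun t => (2 * r)^-1 * g t ^+ 2)).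
  have := @integrableZl _ _ R mu setT measurableT (2 * r)^-1 _ L2g.2.
  by apply: eq_integrable.
apply: (@le_trans _ _ (\int[mu]_t (r / 2 * (f_ k t - f t) ^+ 2 + (2 * r)^-1 * g t ^+ 2))).
  apply: le_Rintegral => //.
  - exact: (integrable_norm id).
  - have := @integrableD _ _ R mu setT measurableT _ _ ib1 ib2.
    by apply: eq_integrable.
  - move=> t _; rewrite normrM -[(f_ k t - f t) ^+ 2]real_normK ?num_real//.
    rewrite -[g t ^+ 2]real_normK ?num_real//.
    move: `|_| `|g t| => a b; rewrite -subr_ge0.
    have -> : r / 2 * a ^+ 2 + (2 * r)^-1 * b ^+ 2 - a * b =
       r / 2 * (a - b / r) ^+ 2 by field; rewrite gt_eqF.
    by rewrite mulr_ge0 ?sqr_ge0// divr_ge0// ltW.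
rewrite RintegralD// !RintegralZl//; last 2 first.
  exact: L2g.2.
  exact: L2d.2.
rewrite -/A.
have h1 : r / 2 * \int[mu]_x (f_ k x - f x) ^+ 2 <= e / 2.
  have : r / 2 * \int[mu]_x (f_ k x - f x) ^+ 2 <= r / 2 * (e / r).
    by rewrite ler_wpM2l// divr_ge0// ltW.
  by rewrite (_ : r / 2 * (e / r) = e / 2)//; field; rewrite gt_eqF.
have h2 : (2 * r)^-1 * A <= e / 2.
  rewrite ler_pdivrMl; last by rewrite mulr_gt0.
  have -> : 2 * r * (e / 2) = A + 1 by rewrite /r; field; rewrite gt_eqF.
  lra.
by rewrite [e]splitr; exact: lerD h1 h2.
Unshelve. all: by end_near. Qed.

Definition cos_int (th a b t : R) : R := \int[mu]_(y in `[a, b]) cos (t * y - th).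

Lemma continuous_cos_lin (th t : R) : continuous (fun y : R => cos (t * y - th)).
Proof.
apply: (continuous_compose (@continuous_cos R)); apply: continuous_sub; last exact: continuous_const.
by apply: continuous_mul; [exact: continuous_const|exact: continuous_idfun].
Qed.

Lemma continuous_cos_int th a b : continuous (cos_int th a b).
Proof.
apply: seq_continuous => u x cu.
have mf k : measurable_fun (`[a, b]%classic : set R) (fun y => cos (u k * y - th)).
  by apply: measurable_funTS; apply: continuous_measurable_fun; exact: continuous_cos_lin.
have cv y : (`[a, b]%classic : set R) y -> cos (u k * y - th) @[k --> \oo] --> cos (x * y - th).
  move=> _; apply: (@cvg_comp _ _ _ (fun k => u k * y - th) cos); last exact: continuous_cos.
  by apply: cvgB; [apply: cvgM => //; exact: cvg_cst|exact: cvg_cst].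
have le k y : (`[a, b]%classic : set R) y -> `|cos (u k * y - th)| <= 1.
  by move=> _; rewrite ler_norml cos_geN1 cos_le1.
have i1 := @integrable_continuous_itv R (fun=> 1) a b (@continuous_const R 1).
by have [] := @dominated_cvg_real R `[a, b]%classic _ _ (fun=> 1)
  (measurable_itv _) mf cv i1 le.
Qed.

Lemma mul_cos_int th a b t : a <= b -> `|t * cos_int th a b t| <= 2.
Proof.
move=> ab; have cc := @continuous_cos_lin th t.
rewrite /cos_int -RintegralZl//; last exact: integrable_continuous_itv.
have dF (y : R) : is_derive y 1 (fun y => sin (t * y - th)) (t * cos (t * y - th)).
  have h : is_derive y 1 (fun y : R => t * y - th) t.
    by apply: is_derive_eq; rewrite /GRing.scale/= mulr1 subr0.
  by apply: (derive_eq (is_derive_comp (is_derive_sin _) h)); rewrite mulrC.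
rewrite (Rintegral_primitive ab dF); last first.
  by apply: continuous_mul => //; exact: continuous_const.
apply: le_trans (ler_normB _ _) _.
have h u : `|sin u| <= 1 :> R by rewrite ler_norml sin_geN1 sin_le1.
have := h (t * b - th); have := h (t * a - th); lra.
Qed.

Lemma norm_cos_int th a b t : a <= b -> `|cos_int th a b t| <= b - a.
Proof.
move=> ab; have cc := @continuous_cos_lin th t.
apply: le_trans (le_normr_Rintegral _ (integrable_continuous_itv _ _ cc)) _ => //.
apply: (@le_trans _ _ (\int[mu]_(y in `[a, b]) 1)).
  apply: le_Rintegral => //.
  - exact: (integrable_norm (integrable_continuous_itv _ _ cc)).
  - exact: (@integrable_continuous_itv _ (fun=> 1) _ _ (@continuous_const R 1)).
  - by move=> y _; rewrite ler_norml cos_geN1 cos_le1.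
rewrite (@Rintegral_primitive _ id (fun=> 1) _ _ ab)//.
exact: (@continuous_const R 1).
Qed.

Lemma real_L2_cos_int th a b : a <= b -> real_L2 (cos_int th a b).
Proof.
move=> ab; have cc := @continuous_cos_int th a b.
have m := continuous_measurable_fun cc; split=> //.
apply: (@le_integrable_real R _ _ (fun t => ((b - a) ^+ 2 + 4) * (jap 1 t ^+ 2)^-1)) => //.
- by apply: continuous_measurable_fun; apply: continuous_exp.
- move=> t _; rewrite ger0_norm ?sqr_ge0//.
  rewrite ler_pdivlMr ?exprn_gt0 ?jap_gt0// sqr_jap mul1r mulrDr mulr1.
  apply: lerD.
    have h := norm_cos_int th t ab.
    by rewrite -[cos_int _ _ _ _ ^+ 2]real_normK ?num_real// ler_pXn2r ?nnegrE ?subr_ge0.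
  rewrite mulrC -exprMn -[(t * _) ^+ 2]real_normK ?num_real//.
  have := mul_cos_int th t ab; set z := `|_| => h.
  have -> : 4 = 2 ^+ 2 :> R by rewrite -natrX.
  by rewrite ler_pXn2r ?nnegrE// /z normr_ge0.
- have := @integrableZl _ _ R mu setT measurableT ((b - a) ^+ 2 + 4) _ (@integrable_invr_sqr_jap R).
  by apply: eq_integrable.
Qed.

Definition cos_transform (f : R -> R) (th y : R) : R :=
  \int[mu]_t (f t * cos (t * y - th)).

Lemma integrable_mul_cos (f : R -> R) th y : mu.-integrable setT (EFin \o f) ->
  mu.-integrable setT (EFin \o (fun t => f t * cos (t * y - th))).
Proof.
move=> fi; have mf : measurable_fun setT f by apply/measurable_EFinP; exact: measurable_int fi.
apply: (@le_integrable_real R _ _ (fun t => `|f t|)) => //.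
- apply: measurable_funM => //; apply: continuous_measurable_fun.
  apply: (continuous_compose (@continuous_cos R)); apply: continuous_sub; last exact: continuous_const.
  by apply: continuous_mul; [exact: continuous_idfun|exact: continuous_const].
- by move=> t _; rewrite normrM ler_piMr// ler_norml cos_geN1 cos_le1.
- exact: (integrable_norm fi).
Qed.

Lemma continuous_cos_transform (f : R -> R) th : mu.-integrable setT (EFin \o f) ->
  continuous (cos_transform f th).
Proof.
move=> fi; apply: seq_continuous => u x cu.
have cv t : setT t -> f t * cos (t * u k - th) @[k --> \oo] --> f t * cos (t * x - th).
  move=> _; apply: cvgM; first exact: cvg_cst.
  apply: (@cvg_comp _ _ _ (fun k => t * u k - th) cos); last exact: continuous_cos.
  by apply: cvgB; [apply: cvgM => //; exact: cvg_cst|exact: cvg_cst].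
have le k t : setT t -> `|f t * cos (t * u k - th)| <= `|f t|.
  by move=> _; rewrite normrM ler_piMr// ler_norml cos_geN1 cos_le1.
have mf k : measurable_fun setT (fun t => f t * cos (t * u k - th)).
  by apply/measurable_EFinP; exact: measurable_int (integrable_mul_cos th (u k) fi).
by have [] := @dominated_cvg_real R setT _ _ _ measurableT mf cv (integrable_norm fi) le.
Qed.

Lemma cos_transform_itv (f : R -> R) th a b : a <= b ->
  mu.-integrable setT (EFin \o f) ->
  mu.-integrable `[a, b] (EFin \o cos_transform f th) /\
  \int[mu]_(y in `[a, b]) cos_transform f th y = \int[mu]_t (f t * cos_int th a b t).
Proof.
move=> ab fi.
have mf : measurable_fun setT f by apply/measurable_EFinP; exact: measurable_int fi.
pose I := `[a, b]%classic : set (measurableTypeR R).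
pose h (z : measurableTypeR R * measurableTypeR R) : R :=
  f z.1 * cos (z.1 * z.2 - th) * \1_I z.2.
have mI : measurable_fun setT (\1_I : measurableTypeR R -> R).
  by apply: measurable_indic; exact: measurable_itv.
have mh : measurable_fun setT (EFin \o h).
  apply/measurable_EFinP; apply: measurable_funM.
    apply: measurable_funM.
      exact: (measurableT_comp mf).
    apply: (measurableT_comp (continuous_measurable_fun (@continuous_cos R))).
    apply: measurable_funB; last exact: measurable_cst.
    exact: measurable_funM.
  exact: (measurableT_comp mI).
have muI : exists c : R, (\int[mu]_y (\1_I y)%:E = c%:E)%E.
  rewrite integral_indic//; last exact: measurable_itv.
  exists (fine (mu (I `&` setT))); rewrite fineK// setIT /I /= lebesgue_measure_itv/= lte_fin.
  by case: ifP.
have ih : (mu \x mu)%E.-integrable setT (EFin \o h).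
  apply/integrable12ltyP => //; have [c cE] := muI.
  apply: (@le_lt_trans _ _ (\int[mu]_x (`|f x|%:E * c%:E))%E).
    apply: ge0_le_integral => //.
    - by move=> x _; exact: integral_ge0.
    - apply: (@measurable_fun_fubini_tonelli_F _ _ _ _ _ mu (abse \o (EFin \o h))) => //.
        exact: measurableT_comp.
      by move=> z; exact: abse_ge0.
    - rewrite (_ : (fun x => _) = EFin \o (fun x => `|f x| * c))//.
      apply/measurable_EFinP; apply: measurable_funM => //.
      by apply: measurableT_comp.
    - move=> x _; rewrite -cE.
      rewrite -ge0_integralZl//; last first.
        by apply/measurable_EFinP.
      apply: ge0_le_integral => //.
      + by do 2 apply: measurableT_comp => //.
      + rewrite (_ : (fun x => _) = EFin \o (fun y => `|f x| * \1_I y))//.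
        by apply/measurable_EFinP; apply: measurable_funM.
      + move=> y _; rewrite lee_fin !normrM ler_pM// ?mulr_ge0//.
          by rewrite ler_piMr// ler_norml cos_geN1 cos_le1.
        by rewrite ger0_norm.
  under eq_integral do rewrite muleC.
  have hz := @integrableZl _ _ R mu setT measurableT c _ (integrable_norm fi).
  by rewrite ltey_eq (integrable_fin_num measurableT hz).
have e1 x : (\int[mu]_y (EFin \o h) (x, y) = (f x * cos_int th a b x)%:E)%E.
  have cc := @continuous_cos_lin th x.
  have -> : (fun y => (EFin \o h) (x, y)) = (EFin \o (fun y => f x * cos (x * y - th))) \_ I.
    apply/funext => y; rewrite patchE /= /h /= indicE; case: ifP => _; rewrite ?mulr1//.
    by rewrite mulr0.
  rewrite -integral_mkcond EFin_Rintegral_itv; last first.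
    by apply: continuous_subspaceT; apply: continuous_mul => //; exact: continuous_const.
  by rewrite RintegralZl//; exact: integrable_continuous_itv.
have e2 y : (\int[mu]_x (EFin \o h) (x, y) = ((EFin \o cos_transform f th) \_ I) y)%E.
  rewrite patchE; case: ifPn => yI.
    rewrite /= /cos_transform /Rintegral fineK; last first.
      by apply: integrable_fin_num => //; exact: integrable_mul_cos.
    by apply: eq_integral => x _; rewrite /h /= indicE yI mulr1.
  by apply: integral0_eq => x _; rewrite /h /= indicE (negbTE yI) mulr0.
have F12 := Fubini ih.
split; first by apply: integrable_continuous_itv; exact: continuous_cos_transform.
rewrite /Rintegral integral_mkcond; congr fine.
under eq_integral do rewrite -e2.
by rewrite -F12; apply: eq_integral => x _; exact: e1.
Qed.

End Pairing.

Section Uniqueness.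
Context {R : realType}.
Notation mu := (@lebesgue_measure R).
Notation Re := (@complex.Re R).
Notation Im := (@complex.Im R).
Implicit Types (f g u : R -> R[i]).

Lemma ReM (z w : R[i]) : Re (z * w) = Re z * Re w - Im z * Im w.
Proof. by case: z w => a b [c d]. Qed.

Lemma ImM (z w : R[i]) : Im (z * w) = Re z * Im w + Im z * Re w.
Proof. by case: z w => a b [c d]. Qed.

Lemma ReB (z w : R[i]) : Re (z - w) = Re z - Re w.
Proof. by case: z w => a b [c d]. Qed.

Lemma ImB (z w : R[i]) : Im (z - w) = Im z - Im w.
Proof. by case: z w => a b [c d]. Qed.

Lemma cexp_phase (x : R) : cexp (- ('i%C * x%:C%C)) = (cos x +i* - sin x)%C.
Proof.
rewrite /cexp/= !(mul0r, mul1r, subr0, addr0, add0r, oppr0, mulr0) expR0.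
by rewrite mul1r cosN sinN.
Qed.

Lemma fourierL1E u y : inL1 u ->
  Re (fourierL1 u y) = (Num.sqrt (2 * pi))^-1 *
    (cos_transform (Re \o u) 0 y + cos_transform (Im \o u) (pi / 2) y) /\
  Im (fourierL1 u y) = (Num.sqrt (2 * pi))^-1 *
    (cos_transform (Im \o u) 0 y - cos_transform (Re \o u) (pi / 2) y).
Proof.
move=> [iRe iIm]; rewrite /fourierL1 ReM ImM /=.
have e1 (t : R) : Re (cexp (- ('i%C * (t * y)%:C%C)) * u t) =
    Re (u t) * cos (t * y - 0) + Im (u t) * cos (t * y - pi / 2).
  rewrite cexp_phase ReM/= subr0 cosB cos_pihalf sin_pihalf mulr0 add0r mulr1.
  ring.
have e2 (t : R) : Im (cexp (- ('i%C * (t * y)%:C%C)) * u t) =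
    Im (u t) * cos (t * y - 0) - Re (u t) * cos (t * y - pi / 2).
  rewrite cexp_phase ImM/= subr0 cosB cos_pihalf sin_pihalf mulr0 add0r mulr1.
  ring.
have i1 := integrable_mul_cos 0 y iRe; have i2 := integrable_mul_cos (pi / 2) y iRe.
have i3 := integrable_mul_cos 0 y iIm; have i4 := integrable_mul_cos (pi / 2) y iIm.
rewrite !mul0r subr0 addr0 /cos_transform -RintegralD// -RintegralB//.
by split; congr (_ * _); apply: eq_Rintegral => t _.
Qed.

Lemma inL2_real f : inL2 f -> real_L2 (Re \o f) /\ real_L2 (Im \o f).
Proof.
move/inL2P => [[m1 m2] fi]; split; split=> //.
- apply: (@le_integrable_real R _ _ (sqnorm f)) => //.
    exact: (measurable_funX 2).
  by move=> t _; rewrite ger0_norm ?sqr_ge0// lerDl sqr_ge0.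
- apply: (@le_integrable_real R _ _ (sqnorm f)) => //.
    exact: (measurable_funX 2).
  by move=> t _; rewrite ger0_norm ?sqr_ge0// lerDr sqr_ge0.
Qed.

Lemma cvgL2_real (f : nat -> R -> R[i]) g : cvgL2 \oo f g ->
  [/\ \forall k \near \oo, real_L2 (Re \o f k), \forall k \near \oo, real_L2 (Im \o f k),
   \int[mu]_t ((Re (f k t) - Re (g t)) ^+ 2) @[k --> \oo] --> (0 : R) &
   \int[mu]_t ((Im (f k t) - Im (g t)) ^+ 2) @[k --> \oo] --> (0 : R)].
Proof.
move=> h; have [L2f L2g _] := h; have cs := cvg_Rintegral_sqnorm h.
have [g1 g2] := inL2_real L2g.
have n1 : \forall k \near \oo, real_L2 (Re \o f k).
  by apply: filterS L2f => k /inL2_real[].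
have n2 : \forall k \near \oo, real_L2 (Im \o f k).
  by apply: filterS L2f => k /inL2_real[].
have sE k t : sqnorm (fun t => f k t - g t) t =
   (Re (f k t) - Re (g t)) ^+ 2 + (Im (f k t) - Im (g t)) ^+ 2.
  by rewrite /sqnorm ReB ImB.
have i0 (v : R -> R) : 0 <= \int[mu]_t (v t ^+ 2).
  by apply: Rintegral_ge0 => t _; exact: sqr_ge0.
split=> //.
- apply: (squeeze_cvgr _ (cvg_cst 0) cs); near=> k.
  have k1 : real_L2 (Re \o f k) by near: k.
  have k2 : real_L2 (Im \o f k) by near: k.
  have [_ j1] := real_L2B k1 g1; have [_ j2] := real_L2B k2 g2.
  rewrite i0/=; under [leRHS]eq_Rintegral do rewrite sE.
  by rewrite RintegralD// lerDl i0.
- apply: (squeeze_cvgr _ (cvg_cst 0) cs); near=> k.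
  have k1 : real_L2 (Re \o f k) by near: k.
  have k2 : real_L2 (Im \o f k) by near: k.
  have [_ j1] := real_L2B k1 g1; have [_ j2] := real_L2B k2 g2.
  rewrite i0/=; under [leRHS]eq_Rintegral do rewrite sE.
  by rewrite RintegralD// lerDr i0.
Unshelve. all: by end_near. Qed.

Lemma real_L2_indic a b : real_L2 (\1_(`[a, b]%classic : set R) : R -> R).
Proof.
have m : measurable_fun setT (\1_(`[a, b]%classic : set R) : R -> R).
  by apply: measurable_indic; exact: measurable_itv.
split=> //.
have mI : measurable (`[a, b]%classic : set (measurableTypeR R)) by exact: measurable_itv.
have h := @integrable_continuous_itv R (fun=> 1) a b (@continuous_const R 1).
have := (@integrable_mkcond _ _ R mu _ _ mI).1 h.
apply: eq_integrable => // t _; rewrite patchE /= indicE.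
by case: ifP => _; rewrite ?expr1n// expr0n.
Qed.

Lemma Rintegral_mul_indic (h : R -> R) a b :
  \int[mu]_t (h t * \1_(`[a, b]%classic : set R) t) = \int[mu]_(t in `[a, b]) h t.
Proof.
rewrite [RHS]Rintegral_mkcond; apply: eq_Rintegral => t _; rewrite patchE indicE.
by case: ifP => _; rewrite ?mulr1// mulr0.
Qed.

Lemma is_fourierL2_itv f g a b : a <= b -> is_fourierL2 f g ->
  \int[mu]_(y in `[a, b]) Re (g y) = (Num.sqrt (2 * pi))^-1 *
    (\int[mu]_t (Re (f t) * cos_int 0 a b t) +
     \int[mu]_t (Im (f t) * cos_int (pi / 2) a b t)) /\
  \int[mu]_(y in `[a, b]) Im (g y) = (Num.sqrt (2 * pi))^-1 *
    (\int[mu]_t (Im (f t) * cos_int 0 a b t) -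
     \int[mu]_t (Re (f t) * cos_int (pi / 2) a b t)).
Proof.
move=> ab [u uL [cu cg]]; set c := (Num.sqrt _)^-1.
have [u1 u2 cu1 cu2] := cvgL2_real cu; have [g1 g2 cg1 cg2] := cvgL2_real cg.
have [_ /inL2_real[f1 f2] _] := cu; have [_ /inL2_real[h1 h2] _] := cg.
have L0 := @real_L2_cos_int R 0 a b ab; have L1 := @real_L2_cos_int R (pi / 2) a b ab.
have LI := real_L2_indic a b.
have p1 := cvg_pairing u1 f1 L0 cu1; have p2 := cvg_pairing u1 f1 L1 cu1.
have p3 := cvg_pairing u2 f2 L0 cu2; have p4 := cvg_pairing u2 f2 L1 cu2.
have q1 := cvg_pairing g1 h1 LI cg1; have q2 := cvg_pairing g2 h2 LI cg2.
have i1 k th := cos_transform_itv th ab (uL k).1.1.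
have i2 k th := cos_transform_itv th ab (uL k).1.2.
have mI : measurable (`[a, b]%classic : set (measurableTypeR R)) by exact: measurable_itv.
split.
- rewrite -Rintegral_mul_indic; apply: (cvg_unique _ q1) => //.
  have -> : (fun k => \int[mu]_t ((Re \o fourierL1 (u k)) t * \1_(`[a, b]%classic : set R) t)) =
     (fun k => c * (\int[mu]_t ((Re \o u k) t * cos_int 0 a b t) +
        \int[mu]_t ((Im \o u k) t * cos_int (pi / 2) a b t))).
    apply/funext => k; rewrite Rintegral_mul_indic.
    have [j1 e1] := i1 k 0; have [j2 e2] := i2 k (pi / 2).
    rewrite -e1 -e2 -RintegralD// -RintegralZl//; last first.
      by have := integrableD mI j1 j2; apply: eq_integrable.
    by apply: eq_Rintegral => y _; exact: (fourierL1E y (uL k).1).1.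
  by apply: cvgM; [exact: cvg_cst|apply: cvgD].
- rewrite -Rintegral_mul_indic; apply: (cvg_unique _ q2) => //.
  have -> : (fun k => \int[mu]_t ((Im \o fourierL1 (u k)) t * \1_(`[a, b]%classic : set R) t)) =
     (fun k => c * (\int[mu]_t ((Im \o u k) t * cos_int 0 a b t) -
        \int[mu]_t ((Re \o u k) t * cos_int (pi / 2) a b t))).
    apply/funext => k; rewrite Rintegral_mul_indic.
    have [j1 e1] := i2 k 0; have [j2 e2] := i1 k (pi / 2).
    rewrite -e1 -e2 -RintegralB// -RintegralZl//; last first.
      by have := integrableB mI j1 j2; apply: eq_integrable.
    by apply: eq_Rintegral => y _; exact: (fourierL1E y (uL k).1).2.
  by apply: cvgM; [exact: cvg_cst|apply: cvgB].
Qed.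

Lemma integrable_itv_L2 (h : R -> R) a b : real_L2 h -> mu.-integrable `[a, b] (EFin \o h).
Proof.
move=> [mh ih].
apply: (@le_integrable_real R _ _ (fun t => 1 + h t ^+ 2)).
- exact: measurable_itv.
- exact: measurable_fun_restr.
- move=> t _; rewrite -[h t ^+ 2]real_normK ?num_real//.
  by have := sqr_ge0 (`|h t| - 1 / 2); rewrite sqrrB; lra.
- have h1 := @integrable_continuous_itv R (fun=> 1) a b (@continuous_const R 1).
  have h2 : mu.-integrable `[a, b] (EFin \o (fun t => h t ^+ 2)).
    by apply: integrableS ih => //; exact: measurable_itv.
  have mI : measurable (`[a, b]%classic : set (measurableTypeR R)) by exact: measurable_itv.
  by have := integrableD mI h1 h2; apply: eq_integrable.
Qed.

Lemma ae_eq0_itv (h : R -> R) : real_L2 h ->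
  (forall a b, a <= b -> \int[mu]_(y in `[a, b]) h y = 0) ->
  {ae mu, forall y, h y = 0}.
Proof.
move=> L2h h0.
have loc : locally_integrable [set: R] h.
  split; [exact: L2h.1|exact: openT|move=> K _ cK].
  have [M [Mr MK]] := compact_bounded cK.
  have KM : K `<=` `[- (`|M| + 1), `|M| + 1].
    move=> x Kx; rewrite /= in_itv/= -ler_norml; apply: (MK (`|M| + 1)) => //.
    by rewrite (le_lt_trans (ler_norm M))// ltrDl.
  have mK := compact_measurable cK.
  have iM := integrable_itv_L2 (- (`|M| + 1)) (`|M| + 1) L2h.
  have mK' : measurable (K : set (measurableTypeR R)) by exact: mK.
  have mI : measurable (`[- (`|M| + 1), `|M| + 1]%classic : set (measurableTypeR R)).
    exact: measurable_itv.
  by have /integrableP[] := integrableS mI mK' KM iM.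
have key (n : nat) : {ae mu, forall y, - n%:R < y -> h y = 0}.
  have ii y : mu.-integrable [set` Interval (BLeft (- n%:R)) (BRight y)] (EFin \o h).
    exact: integrable_itv_L2.
  have := FTC1 ii loc; apply: filterS; first exact: (ae_filter_ringOfSetsType mu).
  move=> x /= hx nx.
  have [|_ <-] := hx; first by rewrite lte_fin.
  rewrite (_ : (fun y => _) = cst 0) ?derive1_cst//.
  apply/funext => y; have [ny|yn] := leP (- n%:R) y; first exact: h0.
  by rewrite set_itv_ge ?Rintegral_set0// bnd_simp -ltNge.
have := ae_foralln key; apply: filterS.
move=> x hx.
apply: (hx (Num.truncn `|x|).+1).
by rewrite ltrNl (le_lt_trans (ler_norm _))// normrN truncnS_gt.
Qed.

Lemma is_fourierL2_unique f g1 g2 : is_fourierL2 f g1 -> is_fourierL2 f g2 ->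
  {ae mu, forall y, g1 y = g2 y}.
Proof.
move=> F1 F2.
have [_ _ [_ [_ /inL2_real[r1 s1] _]]] := F1.
have [_ _ [_ [_ /inL2_real[r2 s2] _]]] := F2.
have Lr := real_L2B r1 r2; have Ls := real_L2B s1 s2.
have diff (h1 h2 : R -> R) : real_L2 h1 -> real_L2 h2 ->
    (forall a b, a <= b -> \int[mu]_(y in `[a, b]) h1 y = \int[mu]_(y in `[a, b]) h2 y) ->
    {ae mu, forall y, h1 y - h2 y = 0}.
  move=> L1 L2 h12; apply: (ae_eq0_itv (real_L2B L1 L2)) => a b ab.
  by rewrite RintegralB ?(h12 _ _ ab) ?subrr//; exact: integrable_itv_L2.
have aer : {ae mu, forall y, Re (g1 y) - Re (g2 y) = 0}.
  apply: diff => // a b ab.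
  by rewrite (is_fourierL2_itv ab F1).1 (is_fourierL2_itv ab F2).1.
have aes : {ae mu, forall y, Im (g1 y) - Im (g2 y) = 0}.
  apply: diff => // a b ab.
  by rewrite (is_fourierL2_itv ab F1).2 (is_fourierL2_itv ab F2).2.
apply: filterS2 aer aes; first exact: (ae_filter_ringOfSetsType mu).
move=> y /=.
case: (g1 y) (g2 y) => [a b] [c d] /= /eqP; rewrite subr_eq0 => /eqP ->.
by move=> /eqP; rewrite subr_eq0 => /eqP ->.
Qed.

End Uniqueness.

(** * The Fourier transform of the basis functions *)

Section Polar.
Context {R : realType}.
Notation mu := (@lebesgue_measure R).
Notation Re := (@complex.Re R).
Notation Im := (@complex.Im R).

Definition cis (x : R) : R[i] := (cos x +i* sin x)%C.

Lemma cisD x y : cis (x + y) = cis x * cis y.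
Proof. by rewrite /cis cosD sinD; congr (_ +i* _)%C; rewrite addrC. Qed.

Lemma cexpE (z : R[i]) : cexp z = (expR (Re z))%:C%C * cis (Im z).
Proof. by []. Qed.

Lemma realcM (a b : R) : (a * b)%:C%C = a%:C%C * b%:C%C.
Proof. by rewrite rmorphM. Qed.

Lemma cexp_imag (x : R) : cexp ('i%C * x%:C%C) = cis x.
Proof.
have -> : 'i%C * x%:C%C = (0 +i* x)%C.
  by apply/eqP; rewrite eq_complex ReM ImM /=; apply/andP; split; apply/eqP; ring.
by rewrite cexpE /= expR0 mul1r.
Qed.

Lemma cexpN_imag (x : R) : cexp (- ('i%C * x%:C%C)) = cis (- x).
Proof.
by rewrite -cexp_imag rmorphN mulrN.
Qed.

Lemma cpow_polar (a r s : R) : 0 < a ->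
  cpow a (r +i* s)%C = (expR (r * ln a))%:C%C * cis (s * ln a).
Proof. by move=> a0; rewrite /cpow cexpE /= !mulr0 subr0 add0r. Qed.

Lemma expR_half_ln (a : R) : 0 < a -> expR (2^-1 * ln a) = Num.sqrt a.
Proof.
move=> a0; apply: (@pexpIrn _ 2) => //; rewrite ?nnegrE ?expR_ge0 ?sqrtr_ge0//.
rewrite sqr_sqrtr ?ltW// -expRM_natl mulrA -mulr_natl mulfV// mul1r.
by rewrite lnK ?posrE.
Qed.

Lemma basis_funE (la m t : R) :
  basis_fun ((- 2^-1) +i* la)%C m t =
  ((Num.sqrt pi)^-1 * (jap 1 t)^-1)%:C%C *
  cis (- (pi * m) + phase m la 0 t).
Proof.
have t0 := one_add_sqr_gt0 t.
rewrite /basis_fun cexpN_imag cexp_imag addrC cpow_polar// mulNr expRN expR_half_ln//.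
rewrite /phase mul0r expr0n addr0 ln1 sub0r mulrN opprK.
rewrite /jap mul1r realcM -!mulrA; congr (_ * _).
by rewrite !cisD; ring.
Qed.

Lemma half_arcoshP (x : R) : 1 <= x ->
  0 <= half_arcosh x /\ x = cosh (2 * half_arcosh x).
Proof.
move=> x1; apply: (@xgetPex _ 0 [set tau | 0 <= tau /\ x = cosh (2 * tau)]).
have s0 : 0 <= x ^+ 2 - 1 by rewrite subr_ge0 expr_ge1//; lra.
set s := Num.sqrt (x ^+ 2 - 1).
have sp : 0 <= s by exact: sqrtr_ge0.
have s2 : s ^+ 2 = x ^+ 2 - 1 by rewrite sqr_sqrtr.
exists (ln (x + s) / 2); split; first by rewrite divr_ge0// ln_ge0//; lra.
have xs : 0 < x + s by lra.
rewrite /cosh (_ : 2 * (ln (x + s) / 2) = ln (x + s)); last by field.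
rewrite expRN lnK ?posrE//.
have -> : (x + s)^-1 = x - s.
  apply: (mulIf (lt0r_neq0 xs)); rewrite mulVf ?lt0r_neq0//.
  have -> : (x - s) * (x + s) = x ^+ 2 - s ^+ 2 by ring.
  by rewrite s2; ring.
by field.
Qed.

Lemma Rintegral_scale_ge0 (f : R -> R) (d : R) : 0 < d -> continuous f ->
  (forall t, 0 <= f t) -> mu.-integrable setT (EFin \o f) ->
  mu.-integrable setT (EFin \o (fun t => f (d^-1 * t))) /\
  \int[mu]_t f (d^-1 * t) = d * \int[mu]_t f t.
Proof.
move=> d0 cf f0 fi; have i0 : 0 < d^-1 by rewrite invr_gt0.
pose F (t : R) : R := d^-1 * t.
have dF (t : R) : is_derive t 1 F d^-1.
  by apply: is_derive_eq; rewrite /GRing.scale/= mulr1.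
have F' : F^`()%classic = fun=> d^-1.
  by apply/funext => t; rewrite derive1E; apply: derive_val.
have cF := is_derive_continuous dF.
have := @increasing_ge0_integration_by_substitutionT R F f.
rewrite F' => /(_ _ _ _ _ _ _ _ cf f0) e.
have {}e : (\int[mu]_x (f x)%:E = \int[mu]_x (f (d^-1 * x) * d^-1)%:E)%E.
  apply: e.
  - by move=> x y xy; rewrite /F ltr_pM2l.
  - exact: (@continuous_const R d^-1).
  - exact: is_cvg_cst.
  - exact: is_cvg_cst.
  - by move=> x; have [] := dF x.
  - by apply: gt0_cvgMrNy => //; exact: cvg_id.
  - by apply: gt0_cvgMry => //; exact: cvg_id.
have cg : continuous (fun t => f (d^-1 * t)) by exact: (continuous_compose cf cF).
have ig' : mu.-integrable setT (EFin \o (fun t => f (d^-1 * t) * d^-1)).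
  apply/integrableP; split.
    apply/measurable_EFinP; apply: continuous_measurable_fun.
    by apply: continuous_mul => //; exact: continuous_const.
  under eq_integral do rewrite /= ger0_norm ?mulr_ge0 ?(ltW i0)//.
  by rewrite -e ltey_eq (integrable_fin_num measurableT fi).
have ig : mu.-integrable setT (EFin \o (fun t => f (d^-1 * t))).
  have := @integrableZl _ _ R mu setT measurableT d _ ig'.
  apply: eq_integrable => // t _ /=; rewrite -EFinM; congr EFin.
  by field; rewrite gt_eqF.
split=> //.
have e2 : \int[mu]_t f t = \int[mu]_t (f (d^-1 * t) * d^-1).
  by rewrite /Rintegral e.
by rewrite e2 RintegralZr// mulrCA mulfV ?gt_eqF// mulr1.
Qed.

(* The library substitutes in integrals of nonnegative functions only, hence the
   decomposition [f = (|f| + f) - |f|]. *)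
Lemma Rintegral_scale (f : R -> R) (d : R) : 0 < d -> continuous f ->
  mu.-integrable setT (EFin \o f) ->
  \int[mu]_t f (d^-1 * t) = d * \int[mu]_t f t.
Proof.
move=> d0 cf fi.
have iabs := integrable_norm fi.
have cabs : continuous (fun t => `|f t|) by exact: (continuous_compose continuous_norm cf).
have isum : mu.-integrable setT (EFin \o (fun t => `|f t| + f t)).
  by have := integrableD measurableT iabs fi; apply: eq_integrable.
have [j1 e1] := Rintegral_scale_ge0 d0 cabs (fun t => normr_ge0 (f t)) iabs.
have p0 t : 0 <= `|f t| + f t by have := ler_norm (- f t); rewrite normrN; lra.
have [j2 e2] := Rintegral_scale_ge0 d0 (continuous_add cabs cf) p0 isum.
have -> : \int[mu]_t f (d^-1 * t) = \int[mu]_t ((`|f (d^-1 * t)| + f (d^-1 * t)) - `|f (d^-1 * t)|).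
  by apply: eq_Rintegral => t _; rewrite addrC addKr.
have -> : \int[mu]_t f t = \int[mu]_t ((`|f t| + f t) - `|f t|).
  by apply: eq_Rintegral => t _; rewrite addrC addKr.
by rewrite !RintegralB// e1 e2 mulrBr.
Qed.

(* The shift by [pi / 2] turns the cosine of [osc] into a sine. *)
Definition cosc n la d al p : R[i] :=
  (\int[mu]_s osc n la d al p s +i* \int[mu]_s osc n la d (al - pi / 2) p s)%C.

Lemma cis_cosc n la d al p b : (forall al, mu.-integrable setT (EFin \o osc n la d al p)) ->
  cis b * cosc n la d al p = cosc n la d (al + b) p.
Proof.
move=> io.
have c1 s : osc n la d (al + b) p s = cos b * osc n la d al p s - sin b * osc n la d (al - pi / 2) p s.
  rewrite /osc.
  have -> : al + b + phase n la d s - p s = (al + phase n la d s - p s) + b by ring.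
  have -> : al - pi / 2 + phase n la d s - p s = (al + phase n la d s - p s) - pi / 2 by ring.
  move: (al + phase n la d s - p s) => X.
  by rewrite cosD cosB cos_pihalf sin_pihalf; ring.
have c2 s : osc n la d (al + b - pi / 2) p s = cos b * osc n la d (al - pi / 2) p s + sin b * osc n la d al p s.
  rewrite /osc.
  have -> : al + b - pi / 2 + phase n la d s - p s = (al + phase n la d s - p s) + b - pi / 2 by ring.
  have -> : al - pi / 2 + phase n la d s - p s = (al + phase n la d s - p s) - pi / 2 by ring.
  move: (al + phase n la d s - p s) => X.
  by rewrite !cosB cosD sinD cos_pihalf sin_pihalf; ring.
have iz c al' : mu.-integrable setT (EFin \o (fun s => c * osc n la d al' p s)).
  by have := @integrableZl _ _ R mu setT measurableT c _ (io al'); apply: eq_integrable.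
rewrite /cosc.
have -> : \int[mu]_s osc n la d (al + b) p s =
   cos b * \int[mu]_s osc n la d al p s - sin b * \int[mu]_s osc n la d (al - pi / 2) p s.
  by under eq_Rintegral do rewrite c1; rewrite RintegralB// !RintegralZl.
have -> : \int[mu]_s osc n la d (al + b - pi / 2) p s =
   cos b * \int[mu]_s osc n la d (al - pi / 2) p s + sin b * \int[mu]_s osc n la d al p s.
  by under eq_Rintegral do rewrite c2; rewrite RintegralD// !RintegralZl.
by congr (_ +i* _)%C; ring.
Qed.

End Polar.

Section Coefficients.
Context {R : realType}.
Notation mu := (@lebesgue_measure R).
Notation Re := (@complex.Re R).
Notation Im := (@complex.Im R).
Notation D := (~` [set 0%R] : set (measurableTypeR R)).
Variables (n la : R).
Notation l := (- 2^-1 +i* la)%C.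

Definition kap : R := (pi * Num.sqrt 2)^-1.

Lemma amp0 t : amp 0 t = (jap 1 t)^-1 :> R.
Proof. by rewrite /amp jap0 invr1 mulr1. Qed.

Lemma Re_cis_scale (r x : R) : Re (r%:C%C * cis x) = r * cos x.
Proof. by rewrite ReM /= mul0r subr0. Qed.

Lemma Im_cis_scale (r x : R) : Im (r%:C%C * cis x) = r * sin x.
Proof. by rewrite ImM /= mul0r addr0. Qed.

Lemma sin_cos_shift (x : R) : sin x = cos (x - pi / 2).
Proof. by rewrite cosB cos_pihalf sin_pihalf mulr0 add0r mulr1. Qed.

Lemma basis_fun_modulated t y :
  cexp (- ('i%C * (t * y)%:C%C)) * basis_fun l n t =
  ((Num.sqrt pi)^-1)%:C%C *
   (osc n la 0 (- (pi * n)) (fun s => y * s) t +i*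
    osc n la 0 (- (pi * n) - pi / 2) (fun s => y * s) t)%C.
Proof.
rewrite basis_funE cexpN_imag mulrCA -cisD realcM -mulrA; congr (_ * _).
rewrite /osc amp0; set X := phase n la 0 t.
have -> : - (pi * n) - pi / 2 + X - y * t = (- (t * y) + (- (pi * n) + X)) - pi / 2 by ring.
have -> : - (pi * n) + X - y * t = - (t * y) + (- (pi * n) + X) by ring.
rewrite -sin_cos_shift; apply/eqP; rewrite eq_complex Re_cis_scale Im_cis_scale/=.
by rewrite !eqxx.
Qed.

Lemma basis_fun_parts t : basis_fun l n t =
  ((Num.sqrt pi)^-1)%:C%C *
   (osc n la 0 (- (pi * n)) (fun s => 0 * s) t +i*
    osc n la 0 (- (pi * n) - pi / 2) (fun s => 0 * s) t)%C.
Proof.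
by rewrite -basis_fun_modulated mulr0 cexpN_imag oppr0 /cis cos0 sin0 mul1r.
Qed.

Lemma Re_realcM (r : R) (z : R[i]) : Re (r%:C%C * z) = r * Re z.
Proof. by rewrite ReM /= mul0r subr0. Qed.

Lemma Im_realcM (r : R) (z : R[i]) : Im (r%:C%C * z) = r * Im z.
Proof. by rewrite ImM /= mul0r addr0. Qed.

Lemma sqnorm_basis_fun t : sqnorm (basis_fun l n) t = pi^-1 * (jap 1 t ^+ 2)^-1.
Proof.
rewrite /sqnorm basis_funE Re_cis_scale Im_cis_scale !exprMn -mulrDr cos2Dsin2 mulr1.
by rewrite !exprVn sqr_sqrtr// pi_ge0.
Qed.

Lemma continuous_osc_linear al y : continuous (osc n la 0 al (fun s => y * s)).
Proof.
by apply: continuous_osc; apply: continuous_mul; [exact: continuous_const|exact: continuous_idfun].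
Qed.

Lemma cmeasurable_basis_fun : cmeasurable (basis_fun l n).
Proof.
split.
- rewrite (_ : (fun t => _) = (fun t => (Num.sqrt pi)^-1 * osc n la 0 (- (pi * n)) (fun s => 0 * s) t)).
    apply: continuous_measurable_fun; apply: continuous_mul; first exact: continuous_const.
    exact: continuous_osc_linear.
  by apply/funext => t; rewrite basis_fun_parts Re_realcM.
- rewrite (_ : (fun t => _) = (fun t => (Num.sqrt pi)^-1 * osc n la 0 (- (pi * n) - pi / 2) (fun s => 0 * s) t)).
    apply: continuous_measurable_fun; apply: continuous_mul; first exact: continuous_const.
    exact: continuous_osc_linear.
  by apply/funext => t; rewrite basis_fun_parts Im_realcM.
Qed.

Lemma integrable_sqnorm_basis_fun : mu.-integrable setT (EFin \o sqnorm (basis_fun l n)).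
Proof.
have := @integrableZl _ _ R mu setT measurableT pi^-1 _ (@integrable_invr_sqr_jap R).
by apply: eq_integrable => // t _; rewrite /= sqnorm_basis_fun.
Qed.

Lemma inL2_basis_fun : inL2 (basis_fun l n).
Proof. by apply/inL2P; split; [exact: cmeasurable_basis_fun|exact: integrable_sqnorm_basis_fun]. Qed.

(* Cut off at [k + 1], because the uniform bounds need a positive cut-off. *)
Definition trunc_basis (k : nat) (t : R) : R[i] :=
  if `|t| <= k.+1%:R then basis_fun l n t else 0.

Lemma trunc_patch k (F : R[i] -> R) t : F 0 = 0 ->
  F (trunc_basis k t) = ((fun t => F (basis_fun l n t)) \_ `[- k.+1%:R, k.+1%:R]) t.
Proof.
move=> F0; rewrite patchE /trunc_basis mem_setE/= in_itv/= -ler_norml.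
by case: ifP.
Qed.

Lemma inL1_trunc_basis k : inL1 (trunc_basis k).
Proof.
have mI : measurable (`[- k.+1%:R, k.+1%:R]%classic : set (measurableTypeR R)) by exact: measurable_itv.
split.
- have h : mu.-integrable `[- k.+1%:R, k.+1%:R] (EFin \o (fun t => Re (basis_fun l n t))).
    rewrite (_ : (fun t => _) = (fun t => (Num.sqrt pi)^-1 * osc n la 0 (- (pi * n)) (fun s => 0 * s) t)).
      apply: integrable_continuous_itv; apply: continuous_mul; first exact: continuous_const.
      exact: continuous_osc_linear.
    by apply/funext => t; rewrite basis_fun_parts Re_realcM.
  have := (@integrable_mkcond _ _ R mu _ _ mI).1 h.
  by apply: eq_integrable => // t _; rewrite (@trunc_patch k Re)// restrict_EFin.
- have h : mu.-integrable `[- k.+1%:R, k.+1%:R] (EFin \o (fun t => Im (basis_fun l n t))).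
    rewrite (_ : (fun t => _) = (fun t => (Num.sqrt pi)^-1 * osc n la 0 (- (pi * n) - pi / 2) (fun s => 0 * s) t)).
      apply: integrable_continuous_itv; apply: continuous_mul; first exact: continuous_const.
      exact: continuous_osc_linear.
    by apply/funext => t; rewrite basis_fun_parts Im_realcM.
  have := (@integrable_mkcond _ _ R mu _ _ mI).1 h.
  by apply: eq_integrable => // t _; rewrite (@trunc_patch k Im)// restrict_EFin.
Qed.

Lemma cmeasurable_trunc_basis k : cmeasurable (trunc_basis k).
Proof.
have [i1 i2] := inL1_trunc_basis k.
by split; apply/measurable_EFinP; [exact: measurable_int i1|exact: measurable_int i2].
Qed.

Lemma inL2_trunc_basis k : inL2 (trunc_basis k).
Proof.
apply/inL2P; split; first exact: cmeasurable_trunc_basis.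
apply: (@le_integrable_real R _ _ (sqnorm (basis_fun l n))) => //.
- exact: measurable_sqnorm (cmeasurable_trunc_basis k).
- move=> t _; rewrite ger0_norm ?sqnorm_ge0// {1}/sqnorm /trunc_basis.
  by case: ifP => // _; rewrite /= expr0n addr0 sqnorm_ge0.
- exact: integrable_sqnorm_basis_fun.
Qed.

Lemma cvgL2_trunc_basis : cvgL2 \oo trunc_basis (basis_fun l n).
Proof.
split; [by apply: nearW => k; exact: inL2_trunc_basis|exact: inL2_basis_fun|].
apply: norm2_cvg0.
have mk k : cmeasurable (fun t => trunc_basis k t - basis_fun l n t).
  have [m1 m2] := cmeasurable_trunc_basis k; have [m3 m4] := cmeasurable_basis_fun.
  split.
    rewrite (_ : (fun t => _) = (fun t => Re (trunc_basis k t) - Re (basis_fun l n t))).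
      exact: measurable_funB.
    by apply/funext => t; rewrite ReB.
  rewrite (_ : (fun t => _) = (fun t => Im (trunc_basis k t) - Im (basis_fun l n t))).
    exact: measurable_funB.
  by apply/funext => t; rewrite ImB.
have cv t : setT t -> sqnorm (fun t => trunc_basis k t - basis_fun l n t) t @[k --> \oo] --> (0 : R).
  move=> _; apply: cvg_near_cst; near=> k.
  rewrite /sqnorm /trunc_basis ifT ?subrr /= ?expr0n ?addr0//.
  near: k; exists (Num.truncn `|t|) => // k /= tk.
  by rewrite (le_trans (ltW (truncnS_gt _)))// ler_nat.
have le k t : setT t -> `|sqnorm (fun t => trunc_basis k t - basis_fun l n t) t| <= sqnorm (basis_fun l n) t.
  move=> _; rewrite ger0_norm ?sqnorm_ge0// {1}/sqnorm /trunc_basis; case: ifP => _.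
    by rewrite subrr /= expr0n addr0 sqnorm_ge0.
  by rewrite ReB ImB /= !sub0r !sqrrN.
have [i0 c0] := @dominated_cvg_real R setT _ _ _ measurableT (fun k => measurable_sqnorm (mk k)) cv
  integrable_sqnorm_basis_fun le.
have ik k : mu.-integrable setT (EFin \o sqnorm (fun t => trunc_basis k t - basis_fun l n t)).
  exact: (@le_integrable_real R _ _ _ measurableT (measurable_sqnorm (mk k)) (le k) integrable_sqnorm_basis_fun).
rewrite (_ : (fun k => _) = EFin \o (fun k => \int[mu]_t sqnorm (fun t => trunc_basis k t - basis_fun l n t) t)).
  apply: cvg_EFin; first exact: nearW.
  by move: c0; rewrite Rintegral_cst ?mul0r.
by apply/funext => k; rewrite /= /Rintegral fineK//; exact: (integrable_fin_num measurableT (ik k)).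
Unshelve. all: by end_near. Qed.

Lemma kapE : (Num.sqrt (2 * pi))^-1 * (Num.sqrt pi)^-1 = kap.
Proof.
rewrite -invfM /kap; congr _^-1.
by rewrite sqrtrM// -mulrA -expr2 sqr_sqrtr ?pi_ge0// mulrC.
Qed.

Lemma fourierL1_trunc_basis k y : fourierL1 (trunc_basis k) y =
  kap%:C%C * (trunc_ft n la (- (pi * n)) y k.+1%:R +i*
              trunc_ft n la (- (pi * n) - pi / 2) y k.+1%:R)%C.
Proof.
have io al := @integrable_continuous_itv R _ (- k.+1%:R) k.+1%:R (@continuous_osc_linear al y).
rewrite /fourierL1 -kapE realcM -mulrA; congr (_ * _).
have key (F : R[i] -> R) al : F 0 = 0 ->
    (forall t, F (cexp (- ('i%C * (t * y)%:C%C)) * basis_fun l n t) =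
       (Num.sqrt pi)^-1 * osc n la 0 al (fun s => y * s) t) ->
    \int[mu]_t F (cexp (- ('i%C * (t * y)%:C%C)) * trunc_basis k t) =
    (Num.sqrt pi)^-1 * trunc_ft n la al y k.+1%:R.
  move=> F0 FE; rewrite /trunc_ft -RintegralZl// [RHS]Rintegral_mkcond.
  apply: eq_Rintegral => t _; rewrite patchE /trunc_basis mem_setE/= in_itv/= -ler_norml.
  by case: ifP => _; rewrite ?mulr0.
rewrite /cintegral (key Re (- (pi * n)))//; last first.
  by move=> t; rewrite basis_fun_modulated Re_realcM.
rewrite (key Im (- (pi * n) - pi / 2))//; last first.
  by move=> t; rewrite basis_fun_modulated Im_realcM.
by apply/eqP; rewrite eq_complex Re_realcM Im_realcM /= !eqxx.
Qed.

Lemma continuous_trunc_ft al N : continuous (fun y => trunc_ft n la al y N).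
Proof.
apply: seq_continuous => u x cu.
apply: (@cvg_osc_itv R n la al x N (fun=> 0) (fun=> al) (fun k s => u k * s)).
- by move=> k; apply: continuous_mul; [exact: continuous_const|exact: continuous_idfun].
- exact: cvg_cst.
- exact: cvg_cst.
- by move=> s; apply: cvgM => //; exact: cvg_cst.
Qed.

Lemma dominated_inL2 (f : R -> R[i]) K : cmeasurable f ->
  (forall y, y != 0 -> Re (f y) ^+ 2 <= K * rho y) ->
  (forall y, y != 0 -> Im (f y) ^+ 2 <= K * rho y) -> inL2 f.
Proof.
move=> mf fr fi; apply/inL2P; split=> //.
have ms := measurable_sqnorm mf.
have irho : mu.-integrable D (EFin \o (fun y => 2 * K * rho y)).
  have := @integrableZl _ _ R mu setT measurableT (2 * K) _ (@integrable_rho R).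
  by move/integrableS; apply => //; exact: measurable_D.
have iD : mu.-integrable D (EFin \o sqnorm f).
  apply: (le_integrable_real (@measurable_D R) _ _ irho); first exact: measurable_fun_restr.
  move=> y /eqP y0; rewrite ger0_norm ?sqnorm_ge0// /sqnorm.
  by have := fr y y0; have := fi y y0; lra.
apply/integrableP; split; first exact/measurable_EFinP.
under eq_integral do rewrite /= ger0_norm ?sqnorm_ge0//.
rewrite lebesgue_integral_setD0; last 2 first.
- exact/measurable_EFinP.
- by move=> x; rewrite lee_fin sqnorm_ge0.
by rewrite ltey_eq (integrable_fin_num (@measurable_D R) iD).
Qed.

Lemma dominated_cvgL2 (f : nat -> R -> R[i]) (a b : R -> R) K :
  (forall k, cmeasurable (f k)) ->
  (forall y, y != 0 -> Re (f k y) @[k --> \oo] --> a y) ->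
  (forall y, y != 0 -> Im (f k y) @[k --> \oo] --> b y) ->
  (forall k y, y != 0 -> Re (f k y) ^+ 2 <= K * rho y) ->
  (forall k y, y != 0 -> Im (f k y) ^+ 2 <= K * rho y) ->
  cvgL2 \oo f (fun y => (a \_ D) y +i* (b \_ D) y)%C.
Proof.
move=> mf ca cb ra rb.
have bound (u : nat -> R -> R) (c : R -> R) y : y != 0 -> u k y @[k --> \oo] --> c y ->
    (forall k, u k y ^+ 2 <= K * rho y) -> (c \_ D) y ^+ 2 <= K * rho y.
  move=> y0 cu uK; rewrite patchE mem_set; last exact/eqP.
  have h : u k y ^+ 2 @[k --> \oo] --> c y ^+ 2.
    by rewrite expr2; under eq_fun do rewrite expr2; apply: cvgM.
  by apply: (cvgr_to_le h); near=> j; exact: uK.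
have meas (u : nat -> R -> R) (c : R -> R) : (forall k, measurable_fun setT (u k)) ->
    (forall y, y != 0 -> u k y @[k --> \oo] --> c y) -> measurable_fun setT (c \_ D).
  move=> mu_ cu; have mc : measurable_fun D c.
    apply: (@measurable_fun_cvg _ _ R D u c) => [k|y /eqP y0]; last exact: cu.
    exact: measurable_fun_restr.
  exact: measurable_patch_D.
split.
- by apply: nearW => k; apply: dominated_inL2 (mf k) (ra k) (rb k).
- apply: (@dominated_inL2 _ K).
  + split; [exact: meas (fun k => (mf k).1) ca|exact: meas (fun k => (mf k).2) cb].
  + by move=> y y0; apply: (bound (fun k y => Re (f k y))) => // [|k]; [exact: ca|exact: ra].
  + by move=> y y0; apply: (bound (fun k y => Im (f k y))) => // [|k]; [exact: cb|exact: rb].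
- apply: norm2_cvg0.
  have h := dominated_cvg_sqr (fun k => (mf k).1) (fun k => (mf k).2) ca cb ra rb.
  have -> : (fun k => \int[mu]_t (sqnorm (fun t => f k t - ((a \_ D) t +i* (b \_ D) t)%C) t)%:E)%E =
    (fun k => \int[mu]_y ((Re (f k y) - (a \_ D) y) ^+ 2 + (Im (f k y) - (b \_ D) y) ^+ 2)%:E)%E.
    by apply/funext => k; apply: eq_integral => y _; rewrite /sqnorm ReB ImB.
  exact: h.
Unshelve. all: by end_near. Qed.

Definition fourier_basis : R -> R[i] := (fun y =>
  ((fun y => kap * lim_ft n la (- (pi * n)) y) \_ D) y +i*
  ((fun y => kap * lim_ft n la (- (pi * n) - pi / 2) y) \_ D) y)%C.

Lemma is_fourierL2_basis_fun : is_fourierL2 (basis_fun l n) fourier_basis.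
Proof.
exists trunc_basis; first by move=> k; split; [exact: inL1_trunc_basis|exact: inL2_trunc_basis].
split; first exact: cvgL2_trunc_basis.
have ReE k y : Re (fourierL1 (trunc_basis k) y) = kap * trunc_ft n la (- (pi * n)) y k.+1%:R.
  by rewrite fourierL1_trunc_basis Re_realcM.
have ImE k y : Im (fourierL1 (trunc_basis k) y) = kap * trunc_ft n la (- (pi * n) - pi / 2) y k.+1%:R.
  by rewrite fourierL1_trunc_basis Im_realcM.
have cv al y : y != 0 -> kap * trunc_ft n la al y k.+1%:R @[k --> \oo] --> kap * lim_ft n la al y.
  move=> y0; apply: cvgM; first exact: cvg_cst.
  have := @cvg_trunc_ft R n la al y y0.
  by rewrite -(cvg_shiftS (fun k => trunc_ft n la al y k%:R)).
have bd al y k : y != 0 -> (kap * trunc_ft n la al y k.+1%:R) ^+ 2 <= kap ^+ 2 * osc_bound n la * rho y.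
  move=> y0; rewrite exprMn -mulrA ler_wpM2l ?sqr_ge0//.
  by apply: sqr_trunc_ft_le.
apply: (@dominated_cvgL2 _ _ _ (kap ^+ 2 * osc_bound n la)).
- move=> k; split.
    rewrite (_ : (fun t => _) = (fun y => kap * trunc_ft n la (- (pi * n)) y k.+1%:R)).
      apply: continuous_measurable_fun; apply: continuous_mul; first exact: continuous_const.
      exact: continuous_trunc_ft.
    by apply/funext => y; rewrite ReE.
  rewrite (_ : (fun t => _) = (fun y => kap * trunc_ft n la (- (pi * n) - pi / 2) y k.+1%:R)).
    apply: continuous_measurable_fun; apply: continuous_mul; first exact: continuous_const.
    exact: continuous_trunc_ft.
  by apply/funext => y; rewrite ImE.
- by move=> y y0; under eq_fun do rewrite ReE; exact: cv.
- by move=> y y0; under eq_fun do rewrite ImE; exact: cv.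
- by move=> k y y0; rewrite ReE; exact: bd.
- by move=> k y y0; rewrite ImE; exact: bd.
Qed.

End Coefficients.

(** * The step functions *)

Section Step.
Context {R : realType}.
Notation mu := (@lebesgue_measure R).
Notation Re := (@complex.Re R).
Notation Im := (@complex.Im R).
Variables (n la : R).
Notation l := (- 2^-1 +i* la)%C.

(* [e^(-2 tau)], where [x = cosh (2 tau)]. *)
Definition dil (x : R) : R := expR (- (2 * half_arcosh x)).

Lemma dil_gt0 x : 0 < dil x.
Proof. exact: expR_gt0. Qed.

Lemma dil_le1 x : 1 <= x -> dil x <= 1.
Proof.
move=> x1; have [t0 _] := half_arcoshP x1.
by rewrite /dil -[leRHS]expR0 ler_expR oppr_le0 mulr_ge0.
Qed.

Lemma dil_eq x : 1 <= x -> 2 * x * dil x = 1 + dil x ^+ 2.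
Proof.
move=> x1; have [_ {1}->] := half_arcoshP x1.
rewrite /cosh -/(dil x) -[expR (2 * _)]invrK -expRN -/(dil x).
by have := dil_gt0 x => d0; field; rewrite gt_eqF.
Qed.

Lemma ln_dil x : ln (dil x) = - (2 * half_arcosh x).
Proof. exact: expRK. Qed.

Lemma conj_polar (r x : R) : ((r%:C * cis x)^*)%C = r%:C%C * cis (- x).
Proof.
rewrite /cis cosN sinN; apply/eqP; rewrite eq_complex /=.
by apply/andP; split; apply/eqP; ring.
Qed.

Lemma coefP_integrand m d tau t : d = expR (- (2 * tau)) ->
  cexp (- (2 * l * tau%:C%C)) * basis_fun l n (expR (2 * tau) * t) *
    ((basis_fun l m t)^*)%C =
  (Num.sqrt d^-1 / pi)%:C%C *
    (osc n la d (- (2 * la * tau) - pi * n + pi * m) (fun s => 2 * m * atan (d * s)) (d^-1 * t) +i*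
     osc n la d (- (2 * la * tau) - pi * n + pi * m - pi / 2) (fun s => 2 * m * atan (d * s)) (d^-1 * t))%C.
Proof.
move=> dE; have d0 : 0 < d by rewrite dE expR_gt0.
have -> : expR (2 * tau) = d^-1 by rewrite dE expRN invrK.
have -> : cexp (- (2 * l * tau%:C%C)) = (Num.sqrt d^-1)%:C%C * cis (- (2 * la * tau)).
  have -> : - (2 * l * tau%:C%C) = (tau +i* (- (2 * la * tau)))%C.
    have -> : 2 = (2%:C)%C :> R[i] by rewrite rmorph_nat.
    by apply/eqP; rewrite eq_complex /=; apply/andP; split; apply/eqP; field.
  rewrite cexpE /=; congr (_%:C%C * _).
  by rewrite -expR_half_ln ?invr_gt0// dE -expRN expRK; congr expR; field.
set s := d^-1 * t.
have ts : t = d * s by rewrite /s mulrA mulfV ?mul1r ?gt_eqF.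
rewrite !basis_funE conj_polar.
have -> : jap 1 t = jap d s by rewrite /jap mul1r ts.
have pE : (Num.sqrt pi)^-1 * (Num.sqrt pi)^-1 = pi^-1 :> R.
  by rewrite -invfM -expr2 sqr_sqrtr// pi_ge0.
set X := - (2 * la * tau) - pi * n + pi * m + phase n la d s - 2 * m * atan (d * s).
transitivity ((Num.sqrt d^-1 / pi)%:C%C * ((amp d s)%:C%C * cis X)).
  rewrite -pE /amp !realcM.
  have -> : X = - (2 * la * tau) + (- (pi * n) + phase n la 0 s) - (- (pi * m) + phase m la 0 t).
    by rewrite /X /phase ts !mul0r expr0n addr0 ln1; ring.
  rewrite !cisD; ring.
congr (_ * _); apply/eqP; rewrite eq_complex Re_cis_scale Im_cis_scale /= /osc eqxx/=.
rewrite sin_cos_shift; apply/eqP; congr (_ * cos _); rewrite /X; ring.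
Qed.

Lemma is_derive_atan_scaled (m d s : R) :
  is_derive s 1 (fun t : R => 2 * m * atan (d * t)) (2 * m * d / jap d s ^+ 2).
Proof.
have h : is_derive s 1 (fun t : R => d * t) d.
  by apply: is_derive_eq; rewrite /GRing.scale/= mulr1.
have h2 := is_derive_comp (is_derive1_atan (d * s)) h.
by apply: is_derive_eq; rewrite /GRing.scale/= sqr_jap; ring.
Qed.

Lemma coefPE m x : 1 <= x -> coefP l m n x =
  (Num.sqrt (dil x) / pi)%:C%C *
   cosc n la (dil x) (- (2 * la * half_arcosh x) - pi * n + pi * m)
     (fun s => 2 * m * atan (dil x * s)).
Proof.
move=> x1; have d0 := dil_gt0 x; have d1 := dil_le1 x1.
have cp : continuous (fun s : R => 2 * m * atan (dil x * s)).
  exact: is_derive_continuous (is_derive_atan_scaled m (dil x)).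
rewrite /coefP; set tau := half_arcosh x; set d := dil x.
have key (F : R[i] -> R) al :
    (forall t, F (cexp (- (2 * l * tau%:C%C)) * basis_fun l n (expR (2 * tau) * t) *
      ((basis_fun l m t)^*)%C) =
      Num.sqrt d^-1 / pi * osc n la d al (fun s => 2 * m * atan (d * s)) (d^-1 * t)) ->
    \int[mu]_t F (cexp (- (2 * l * tau%:C%C)) * basis_fun l n (expR (2 * tau) * t) *
      ((basis_fun l m t)^*)%C) =
    Num.sqrt d / pi * \int[mu]_s osc n la d al (fun s => 2 * m * atan (d * s)) s.
  move=> FE; under eq_Rintegral do rewrite FE.
  have io := integrable_osc n la al d0 d1 cp.
  rewrite (@Rintegral_scale _ (fun s => Num.sqrt d^-1 / pi * osc n la d al (fun s => 2 * m * atan (d * s)) s))//.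
  - rewrite RintegralZl// mulrA; congr (_ * _).
    rewrite sqrtrV ?(ltW d0)// mulrA; congr (_ / _).
    have s0 : 0 < Num.sqrt d by rewrite sqrtr_gt0.
    by rewrite -{1}[d]sqr_sqrtr ?(ltW d0)// expr2 mulfK// gt_eqF.
  - by apply: continuous_mul; [exact: continuous_const|exact: continuous_osc].
  - by have := @integrableZl _ _ R mu setT measurableT (Num.sqrt d^-1 / pi) _ io; apply: eq_integrable.
have dE : d = expR (- (2 * tau)) by [].
rewrite /cintegral /cosc (key Re (- (2 * la * tau) - pi * n + pi * m)); last first.
  by move=> t; rewrite (coefP_integrand m t dE) Re_realcM.
rewrite (key Im (- (2 * la * tau) - pi * n + pi * m - pi / 2)); last first.
  by move=> t; rewrite (coefP_integrand m t dE) Im_realcM.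
by apply/eqP; rewrite eq_complex Re_realcM Im_realcM /= !eqxx.
Qed.

Definition step_coef (d m : R) : R[i] :=
  (kap * Num.sqrt (1 + d ^+ 2))%:C%C *
  cosc n la d (- (pi * n) + la * ln (1 + d ^+ 2)) (fun s => 2 * m * atan (d * s)).

Lemma step_coefE m x : 1 <= x ->
  cpow (2 * x) (l + 1) / (Num.sqrt 2)%:C%C *
    (cexp (- ('i%C * (pi * m)%:C%C)) * coefP l m n x) = step_coef (dil x) m.
Proof.
move=> x1; have d0 := dil_gt0 x; have d1 := dil_le1 x1; have de := dil_eq x1.
have x0 : 0 < 2 * x by lra.
have io al := integrable_osc n la al d0 d1
  (is_derive_continuous (is_derive_atan_scaled m (dil x))).
have -> : l + 1 = (2^-1 +i* la)%C.
  by apply/eqP; rewrite eq_complex /= addr0 eqxx andbT; apply/eqP; field.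
rewrite cpow_polar// expR_half_ln// cexpN_imag coefPE// -fmorphV.
transitivity ((Num.sqrt (2 * x) * (Num.sqrt 2)^-1 * (Num.sqrt (dil x) / pi))%:C%C *
  (cis (la * ln (2 * x) - pi * m) *
   cosc n la (dil x) (- (2 * la * half_arcosh x) - pi * n + pi * m)
     (fun s => 2 * m * atan (dil x * s)))).
  by rewrite cisD !realcM; ring.
rewrite cis_cosc// /step_coef; congr (_%:C%C * cosc _ _ _ _ _).
  rewrite -de [in RHS]sqrtrM ?(ltW x0)// /kap invfM; ring.
have -> : ln (1 + dil x ^+ 2) = ln (2 * x) - 2 * half_arcosh x.
  by rewrite -de lnM ?posrE// ln_dil.
ring.
Qed.

Definition step_index (eps x y : R) : R := eps + (Num.floor (x * y - eps))%:~R.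

Lemma step_indexP eps x y : step_index eps x y <= x * y < step_index eps x y + 1.
Proof.
rewrite /step_index; have /andP[h1 h2] := floor_itv (x * y - eps).
by move: h2; rewrite intrD => h2; apply/andP; split; lra.
Qed.

Lemma step_funE eps x y : 1 <= x ->
  step_fun l eps n x y = step_coef (dil x) (step_index eps x y).
Proof.
move=> x1; have x0 : 0 < x by lra.
have /andP[i1 i2] := step_indexP eps x y.
rewrite -step_coefE// /step_fun; congr (_ * _).
rewrite -(@fsbig_widen _ _ _ _ [set step_index eps x y]).
- rewrite fsbig_set1 indicE mem_set ?mulr1//= in_itv/=.
  by rewrite ler_pdivrMr// ltr_pdivlMr// mulrC i1.
- by move=> _ ->; exists (Num.floor (x * y - eps)).
- move=> m [[k _ <-] hk] /=; rewrite indicE.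
  have [yI|] := boolP (y \in _); last by rewrite mulr0.
  exfalso; apply: hk => /=; rewrite /step_index; congr (_ + _%:~R); apply/esym.
  move: yI; rewrite inE/= in_itv/= ler_pdivrMr// ltr_pdivlMr// mulrC => /andP[k1 k2].
  by apply: floor_def; rewrite intrD; apply/andP; split; lra.
Qed.

Lemma measurable_fun_floor (F : int -> R) (eps x : R) :
  measurable_fun setT (fun y : R => F (Num.floor (x * y - eps))).
Proof.
move=> _ Y mY; rewrite setTI.
pose A (k : int) : set R := if F k \in Y then (fun y => x * y - eps) @^-1` `[k%:~R, (k + 1)%:~R[%classic else set0.
have mA k : measurable (A k).
  rewrite /A; case: ifP => // _.
  have mf : measurable_fun setT (fun y : R => x * y - eps).
    apply: continuous_measurable_fun; apply: continuous_sub; last exact: continuous_const.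
    by apply: continuous_mul; [exact: continuous_const|exact: continuous_idfun].
  rewrite -[X in measurable X]setTI; apply: mf => //; exact: measurable_itv.
have -> : (fun y => F (Num.floor (x * y - eps))) @^-1` Y =
    (\bigcup_(i : nat) A i%:Z) `|` (\bigcup_(i : nat) A (- i%:Z)).
  apply/seteqP; split => y /=.
    move=> Yy; have hA : A (Num.floor (x * y - eps)) y.
      by rewrite /A mem_set//= in_itv/= floor_itv.
    have := hA; case: (Num.floor (x * y - eps)) => i h; first by left; exists i.
    by right; exists i.+1 => //; rewrite -NegzE.
  have hk k : A k y -> Y (F (Num.floor (x * y - eps))).
    rewrite /A; case: ifPn => // Yk; rewrite /= in_itv/= => /floor_def ->.
    exact/set_mem.
  by case=> [[i _ /hk]|[i _ /hk]].
by apply: measurableU; exact: bigcup_measurable.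
Qed.

Lemma cmeasurable_step_fun eps x : 1 <= x -> cmeasurable (step_fun l eps n x).
Proof.
move=> x1; split.
- rewrite (_ : (fun t => _) = fun y => (fun k : int => Re (step_coef (dil x) (eps + k%:~R)))
     (Num.floor (x * y - eps))).
    exact: (@measurable_fun_floor (fun k : int => Re (step_coef (dil x) (eps + k%:~R)))).
  by apply/funext => y; rewrite step_funE.
- rewrite (_ : (fun t => _) = fun y => (fun k : int => Im (step_coef (dil x) (eps + k%:~R)))
     (Num.floor (x * y - eps))).
    exact: (@measurable_fun_floor (fun k : int => Im (step_coef (dil x) (eps + k%:~R)))).
  by apply/funext => y; rewrite step_funE.
Qed.

Lemma step_freq eps x y : 1 <= x ->
  `|2 * step_index eps x y * dil x - (1 + dil x ^+ 2) * y| <= 2 * dil x.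
Proof.
move=> x1; rewrite -dil_eq//; have d0 := dil_gt0 x.
have /andP[i1 i2] := step_indexP eps x y.
have -> : 2 * step_index eps x y * dil x - 2 * x * dil x * y =
   2 * dil x * (step_index eps x y - x * y) by ring.
rewrite normrM ger0_norm ?mulr_ge0 ?(ltW d0)// ler_piMr ?mulr_ge0 ?(ltW d0)//.
by rewrite ler_norml; apply/andP; split; lra.
Qed.

Definition step_bound : R := 2 * kap ^+ 2 * osc_bound n la.

Lemma step_part_le eps x y al : 1 <= x -> y != 0 ->
  (kap * Num.sqrt (1 + dil x ^+ 2) * \int[mu]_s osc n la (dil x) al
     (fun s => 2 * step_index eps x y * atan (dil x * s)) s) ^+ 2 <= step_bound * rho y.
Proof.
move=> x1 y0; have d0 := dil_gt0 x; have d1 := dil_le1 x1.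
have d01 : 0 <= dil x <= 1 by rewrite (ltW d0).
have h := sqr_osc_full_le n la al (is_derive_atan_scaled (step_index eps x y) (dil x)) d01 d0 y0
  (step_freq eps y x1).
rewrite exprMn exprMn sqr_sqrtr ?addr_ge0 ?sqr_ge0//.
have hd : 1 + dil x ^+ 2 <= 2.
  have : dil x ^+ 2 <= 1 by rewrite expr_le1// ltW.
  lra.
rewrite /step_bound -[leRHS]mulrA; apply: ler_pM => //.
- by rewrite mulr_ge0 ?sqr_ge0// addr_ge0 ?sqr_ge0.
- exact: sqr_ge0.
- by rewrite mulrC ler_wpM2r// sqr_ge0.
Qed.

Lemma inL2_step_fun eps x : 1 <= x -> inL2 (step_fun l eps n x).
Proof.
move=> x1; apply: (@dominated_inL2 _ _ step_bound); first exact: cmeasurable_step_fun.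
- by move=> y y0; rewrite step_funE// Re_realcM; exact: step_part_le.
- by move=> y y0; rewrite step_funE// Im_realcM; exact: step_part_le.
Qed.

Lemma cvg_ext (T : Type) (F : set_system T) (f g : T -> R) (c : R) :
  f =1 g -> f x @[x --> F] --> c -> g x @[x --> F] --> c.
Proof. by move=> /funext ->. Qed.

Section Limit.
Variables (eps : R) (x_ : nat -> R).
Hypothesis x_ge1 : forall k, 1 <= x_ k.
Hypothesis x_cvg : x_ k @[k --> \oo] --> +oo.

Lemma cvg_dil : dil (x_ k) @[k --> \oo] --> (0 : R).
Proof.
have cV : (x_ k)^-1 @[k --> \oo] --> (0 : R).
  by apply/gtr0_cvgV0 => //; apply: nearW => k; exact: lt_le_trans ltr01 (x_ge1 k).
apply: (squeeze_cvgr _ (cvg_cst 0) cV); apply: nearW => k.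
have d0 := dil_gt0 (x_ k); have d1 := dil_le1 (x_ge1 k).
have x0 : 0 < x_ k by exact: lt_le_trans ltr01 (x_ge1 k).
rewrite (ltW d0)/= -[leRHS]mul1r ler_pdivlMr//.
have de := dil_eq (x_ge1 k).
have : dil (x_ k) ^+ 2 <= 1 by rewrite expr_le1// ltW.
lra.
Qed.

Lemma cvg_one_add_sqr_dil : 1 + dil (x_ k) ^+ 2 @[k --> \oo] --> (1 : R).
Proof.
have : 1 + dil (x_ k) ^+ 2 @[k --> \oo] --> 1 + 0 * (0 : R).
  apply: cvgD; first exact: cvg_cst.
  by under eq_fun do rewrite expr2; apply: cvgM; exact: cvg_dil.
by rewrite mul0r addr0.
Qed.

Lemma cvg_step_freq y :
  2 * step_index eps (x_ k) y * dil (x_ k) @[k --> \oo] --> y.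
Proof.
have c0 : (2 * dil (x_ k) + dil (x_ k) ^+ 2 * `|y|) @[k --> \oo] --> (0 : R).
  rewrite -[X in _ --> X](_ : 2 * 0 + 0 * 0 * `|y| = 0); last by ring.
  apply: cvgD; first by apply: cvgM; [exact: cvg_cst|exact: cvg_dil].
  apply: cvgM; last exact: cvg_cst.
  by under eq_fun do rewrite expr2; apply: cvgM; exact: cvg_dil.
apply/cvgrPdist_le => e e0; near=> k.
apply: (@le_trans _ _ (2 * dil (x_ k) + dil (x_ k) ^+ 2 * `|y|)).
  have h := step_freq eps y (x_ge1 k); set w := 2 * _ * _ in h *.
  have -> : y - w = - (w - (1 + dil (x_ k) ^+ 2) * y) - dil (x_ k) ^+ 2 * y by ring.
  apply: le_trans (ler_normB _ _) _; rewrite normrN normrM (ger0_norm (sqr_ge0 _)).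
  by rewrite lerD2r.
have : `|0 - (2 * dil (x_ k) + dil (x_ k) ^+ 2 * `|y|)| <= e.
  by near: k; move/cvgrPdist_le : c0; apply.
by rewrite sub0r normrN; apply: le_trans; exact: ler_norm.
Unshelve. all: by end_near. Qed.

Lemma cvg_atan_div : h^-1 * atan h @[h --> (0 : R)^'] --> (1 : R).
Proof.
have [hd hv] := is_derive1_atan (0 : R).
move: hd; rewrite /derivable => /cvg_ex[v /= cv].
have ev : 'D_1 (@atan R) 0 = v by apply: cvg_lim => //; exact: norm_hausdorff.
have v1 : v = 1 by rewrite -ev hv expr0n addr0 invr1.
rewrite -v1; apply: (cvg_ext _ cv) => h.
by rewrite /GRing.scale/= mulr1 addr0 atan0 subr0.
Qed.

Lemma cvg_step_phase y s :
  2 * step_index eps (x_ k) y * atan (dil (x_ k) * s) @[k --> \oo] --> y * s.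
Proof.
have [->|s0] := eqVneq s 0.
  by under eq_fun do rewrite mulr0 atan0 mulr0; rewrite mulr0; exact: cvg_cst.
have cds : (dil (x_ k) * s)^-1 * atan (dil (x_ k) * s) @[k --> \oo] --> (1 : R).
  move/cvgr_dnbhsP : cvg_atan_div => /(_ (fun k => dil (x_ k) * s)); apply; split.
    by move=> k; rewrite mulf_neq0// gt_eqF// dil_gt0.
  by rewrite -(mul0r s); apply: cvgM; [exact: cvg_dil|exact: cvg_cst].
have c : 2 * step_index eps (x_ k) y * dil (x_ k) * s *
    ((dil (x_ k) * s)^-1 * atan (dil (x_ k) * s)) @[k --> \oo] --> y * s * 1.
  apply: cvgM => //; apply: cvgM; [exact: cvg_step_freq|exact: cvg_cst].
rewrite mulr1 in c; apply: (cvg_ext _ c) => k.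
by field; rewrite s0 gt_eqF// dil_gt0.
Qed.

Lemma cvg_step_part al_ al y : y != 0 -> al_ k @[k --> \oo] --> al ->
  kap * Num.sqrt (1 + dil (x_ k) ^+ 2) * \int[mu]_s osc n la (dil (x_ k)) (al_ k)
     (fun s => 2 * step_index eps (x_ k) y * atan (dil (x_ k) * s)) s @[k --> \oo] -->
  kap * lim_ft n la al y.
Proof.
move=> y0 cal.
have c1 : Num.sqrt (1 + dil (x_ k) ^+ 2) @[k --> \oo] --> (1 : R).
  rewrite -[X in _ --> X]sqrtr1; apply: (@cvg_comp _ _ _ (fun k => 1 + dil (x_ k) ^+ 2) Num.sqrt);
    last exact: sqrt_continuous.
  exact: cvg_one_add_sqr_dil.
rewrite -[kap in X in _ --> X]mulr1.
apply: cvgM; first by apply: cvgM; [exact: cvg_cst|exact: c1].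
apply: (@cvg_osc_full R n la al y (fun k => dil (x_ k)) al_
  (fun k => 2 * step_index eps (x_ k) y * dil (x_ k))) => //.
- by move=> k s; exact: is_derive_atan_scaled.
- by move=> k; rewrite dil_gt0 dil_le1.
- by move=> k; exact: step_freq.
- exact: cvg_dil.
- exact: cvg_step_phase.
Qed.

Lemma cvgL2_step_fun :
  cvgL2 \oo (fun k => step_fun l eps n (x_ k)) (fourier_basis n la).
Proof.
have cal c : - (pi * n) + la * ln (1 + dil (x_ k) ^+ 2) - c @[k --> \oo] --> - (pi * n) - c.
  rewrite -[X in _ --> X](_ : - (pi * n) + la * 0 - c = _); last by ring.
  apply: cvgB; last exact: cvg_cst.
  apply: cvgD; first exact: cvg_cst.
  apply: cvgM; first exact: cvg_cst.
  rewrite -[X in _ --> X](@ln1 R); apply: (@cvg_comp _ _ _ (fun k => 1 + dil (x_ k) ^+ 2) (@ln R));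
    last by apply: continuous_ln.
  exact: cvg_one_add_sqr_dil.
apply: (@dominated_cvgL2 _ _ _ _ step_bound).
- by move=> k; exact: cmeasurable_step_fun.
- move=> y y0; under eq_fun do rewrite step_funE// Re_realcM/=.
  apply: cvg_step_part => //.
  by have := cal 0; rewrite subr0; under eq_fun do rewrite subr0.
- move=> y y0; under eq_fun do rewrite step_funE// Im_realcM/=.
  by apply: cvg_step_part.
- by move=> k y y0; rewrite step_funE// Re_realcM; exact: step_part_le.
- by move=> k y y0; rewrite step_funE// Im_realcM; exact: step_part_le.
Qed.

End Limit.

End Step.

Unset Implicit Arguments.
Local Open Scope complex_scope.
Local Open Scope ring_scope.

Theorem corollary1p6 (R : realType) (n lambda eps : R) (l : R[i])
    (hl : l = (- 2^-1) +i* lambda) (hn : coset_int eps n) :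
  cvgL2 +oo (fun x y : R => step_fun l eps n x y)
            (fourierL2 (basis_fun l n)).
Proof.
rewrite hl {hl}; set l0 := (_ +i* _)%C.
have F0 := is_fourierL2_basis_fun n lambda.
have F1 : is_fourierL2 (basis_fun l0 n) (fourierL2 (basis_fun l0 n)).
  exact: (@xgetPex _ (fun=> 0) [set g | is_fourierL2 (basis_fun l0 n) g]
    (ex_intro _ _ F0)).
have [_ _ [_ [_ L2g _]]] := F1.
split=> //.
  near=> x; apply: inL2_step_fun.
  by near: x; exact: nbhs_pinfty_ge.
have [_ _ [_ [_ L2g0 _]]] := F0.
apply/cvge_pinftyP => u cu.
pose v k := Num.max (u k) 1.
have v1 k : 1 <= v k by rewrite le_max lexx orbT.
have uv : \forall k \near \oo, v k = u k.
  move/cvgryPge : cu => /(_ 1); apply: filterS => k uk; exact/max_idPl.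
have cv : v k @[k --> \oo] --> +oo.
  move/cvgryPge : cu => cu; apply/cvgryPge => A.
  by apply: filterS (cu A) => k Ak; rewrite le_max Ak.
have [_ _ h] := cvgL2_step_fun n lambda eps v1 cv.
have aeg := is_fourierL2_unique F0 F1.
apply: cvg_trans h; apply: near_eq_cvg.
apply: filterS uv => k <-.
have mB (f g : R -> R[i]) : inL2 f -> inL2 g -> measurable_fun setT (fun t => (sqnorm (fun t => f t - g t) t)%:E).
  move=> [[f1 f2] _] [[g1 g2] _]; apply/measurable_EFinP; apply: measurable_sqnorm; split.
    by rewrite (_ : (fun t => _) = (fun t => complex.Re (f t) - complex.Re (g t)));
      [exact: measurable_funB|apply/funext => t; rewrite ReB].
  by rewrite (_ : (fun t => _) = (fun t => complex.Im (f t) - complex.Im (g t)));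
    [exact: measurable_funB|apply/funext => t; rewrite ImB].
have L2s := inL2_step_fun n lambda eps (v1 k).
rewrite !norm2E; congr (_ `^ _)%E.
apply: ge0_ae_eq_integral => //.
- exact: mB.
- exact: mB.
- by move=> t _; rewrite lee_fin sqnorm_ge0.
- by move=> t _; rewrite lee_fin sqnorm_ge0.
- move: aeg; apply: filterS.
    exact: (ae_filter_ringOfSetsType (@lebesgue_measure R)).
  by move=> t e _; rewrite /sqnorm e.
Unshelve. all: by end_near. Qed.
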